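(* Let $g\in C^{1,\alpha}(\partial B(0,1))$ for some $\alpha\in(0,1)$, viewed as a $2\pi$-periodic function of the angle, where $B(0,1)\subset\mathbb{R}^2$ is the unit disk. Let $u$ be the solution of $$\Delta u=0\ \text{in }B(0,1),\qquad u=g\ \text{on }\partial B(0,1),$$ and let $\omega$ be the solution of $$\Delta\omega=0\ \text{in }B(0,1),\qquad \frac{\partial\omega}{\partial\nu}=g'\ \text{on }\partial B(0,1),\qquad\int_{B(0,1)}\omega\,dx=0.$$ Then $$Du(re^{i\phi})=D\omega(re^{i\phi})\cdot e^{i\frac\pi2}\qquad\forall r\in(0,1),\ \forall\phi\in\mathbb{R}.$$
   Context: $\mathbb{R}^2$ is identified with $\mathbb{C}$; gradients are regarded as complex numbers, so multiplication by $e^{i\pi/2}$ is counterclockwise rotation by $\pi/2$. $\nu$ is the outward unit normal and $g'$ is the derivative of $g$ with respect to the angle. Since $g'$ may be merely continuous (Hölder), $\omega$ is the function given by $\omega(x)=-\frac1\pi\int_{-\pi}^{\pi}\log|x-e^{i\tau}|\,g'(\tau)\,d\tau$, which is the solution of the stated Neumann problem. *)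

(* Defs.v *)
From Stdlib Require Import Reals.
From Coquelicot Require Import Coquelicot.
Open Scope R_scope.

(* R^2 is identified with C through Coquelicot's C = R * R. *)

(* e^{it} *)
Definition cis (t : R) : C := (cos t, sin t).

Definition open_disk (z : C) : Prop := Cmod z < 1.
Definition closed_disk (z : C) : Prop := Cmod z <= 1.

Definition ex_dx (f : C -> R) (z : C) : Prop :=
  ex_derive (fun x => f (x, snd z)) (fst z).
Definition ex_dy (f : C -> R) (z : C) : Prop :=
  ex_derive (fun y => f (fst z, y)) (snd z).
Definition dx (f : C -> R) (z : C) : R :=
  Derive (fun x => f (x, snd z)) (fst z).
Definition dy (f : C -> R) (z : C) : R :=
  Derive (fun y => f (fst z, y)) (snd z).

Definition grad (f : C -> R) (z : C) : C := (dx f z, dy f z).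

Definition laplacian (f : C -> R) (z : C) : R := dx (dx f) z + dy (dy f) z.

(* U is meant to be open, in C1_on, C2_on and harmonic_on. *)
Definition C1_on (U : C -> Prop) (f : C -> R) : Prop :=
  forall z, U z ->
    ex_dx f z /\ ex_dy f z /\ continuous (dx f) z /\ continuous (dy f) z.

Definition C2_on (U : C -> Prop) (f : C -> R) : Prop :=
  C1_on U f /\ C1_on U (dx f) /\ C1_on U (dy f).

Definition harmonic_on (U : C -> Prop) (f : C -> R) : Prop :=
  C2_on U f /\ forall z, U z -> laplacian f z = 0.

(* A function on the unit circle is a 2 PI-periodic function of the angle.
   For such functions, Hoelder continuity of g' with respect to the angle and
   with respect to the distance on the circle are the same condition.
   s <> t is required because Rpower 0 alpha is not 0. *)
Definition C1_alpha_circle (alpha : R) (g : R -> R) : Prop :=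
  (forall t, g (t + 2 * PI) = g t) /\
  (forall t, ex_derive g t) /\
  exists K, forall s t, s <> t ->
    Rabs (Derive g s - Derive g t) <= K * Rpower (Rabs (s - t)) alpha.

(* Classical solution, in C^2(B) and continuous up to the boundary. *)
Definition dirichlet_solution (g : R -> R) (u : C -> R) : Prop :=
  harmonic_on open_disk u /\
  continuous_on closed_disk u /\
  forall t, u (cis t) = g t.

(* The outward unit normal at e^{it} is e^{it} itself; the normal derivative is
   one-sided, taken from inside the disk. *)
Definition has_normal_derivative (w : C -> R) (t l : R) : Prop :=
  filterlim (fun s : R => (w (s * cis t)%C - w (cis t)) / (s - 1))
    (at_left 1) (locally l).

(* Meant for w continuous on the closed disk, where the iterated integral is the
   area integral. *)
Definition disk_integral (w : C -> R) : R :=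
  RInt (fun x =>
    RInt (fun y => w (x, y)) (- sqrt (1 - x ^ 2)) (sqrt (1 - x ^ 2))) (-1) 1.

(* Classical solution with zero mean, in C^2(B) and continuous up to the
   boundary, whose normal derivative exists pointwise. *)
Definition neumann_solution (h : R -> R) (w : C -> R) : Prop :=
  harmonic_on open_disk w /\
  continuous_on closed_disk w /\
  (forall t, has_normal_derivative w t (h t)) /\
  disk_integral w = 0.

Definition neumann_potential (h : R -> R) (x : C) : R :=
  - (1 / PI) * RInt (fun tau => ln (Cmod (x - cis tau)%C) * h tau) (- PI) PI.

(* Main.v *)
Require Import Defs.
From Stdlib Require Import Reals ZArith Lra Lia Classical IndefiniteDescription.
From Coquelicot Require Import Coquelicot.
Open Scope R_scope.

(** Write [v] for the logarithmic potential of [g'] and [P] for the Poisson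
    integral of [g].  Integrating by parts in the derivatives of the Poisson
    kernel shows that [v] is a harmonic conjugate of [P], which is the assertion
    for these two functions.  The maximum principle gives [u = P].

    For a classical Neumann solution, [r dv/dr] is the Poisson integral of [g'],
    so [v] extends continuously to the closed disk with normal derivative [g'].
    Hence [w = omega - v] is harmonic, continuous on the closed disk, with zero
    normal derivative.  A barrier argument on the half disk shows that [w] is
    invariant under reflection in every line through [0], so it is radial, and
    the maximum principle makes it constant. *)

(** * Maximum principle *)

(** For [w] itself no barrier exists on the whole disk: a strictly subharmonic function has positive
    total flux through the circle, so its normal derivative cannot be negative everywhere.
    Subtracting the reflected function makes the difference vanish on a diameter, where the barrier
    is allowed to be maximal. The normal derivative is given only as a pointwise one-sided limit,
    without uniformity in the angle, which gives no direct grip for Green's formula; the barrier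
    uses this limit at a single pair of conjugate points.

    The conjugacy is visible on kernels: in the direction [(a, b)] the derivative of [v] is
    [- (1 / PI) * grad_log g' a b] and that of [P] is [1 / PI * grad_log g' (- b) a], the same
    integral with the direction turned by a quarter turn.

    On the circle the logarithmic integrand is unbounded, so the boundary values of [v] are defined
    as limits along radii. The zero mean of [g'] over a period is what turns the radial derivative
    of [v] into a pure Poisson integral. *)

Lemma continuous_on_eps (S : C -> Prop) (f : C -> R) :
  continuous_on S f <->
  forall z, S z -> forall eps, 0 < eps -> exists d, 0 < d /\
    forall z', S z' -> Rabs (fst z' - fst z) < d -> Rabs (snd z' - snd z) < d ->
      Rabs (f z' - f z) < eps.
Proof.
  split.
  - intros H z Sz eps He.
    destruct (H z Sz (fun y => Rabs (y - f z) < eps)) as [d Hd].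
    { exists (mkposreal eps He). intros y Hy. exact Hy. }
    exists d. split; [apply cond_pos|].
    intros z' Sz' H1 H2. apply Hd; [|exact Sz']. split; assumption.
  - intros H z Sz P [eps HP].
    destruct (H z Sz eps (cond_pos eps)) as [d [Hd Hd']].
    exists (mkposreal d Hd). intros z' [H1 H2] Sz'. apply HP, Hd'; assumption.
Qed.

(** Compactness in the form suited to [compactness_value_2d]: a fixed rectangle that contains the
    set, and openness of the complement. *)
Definition closed_in_unit_box (S : C -> Prop) : Prop :=
  (forall z, S z -> Rabs (fst z) <= 1 /\ Rabs (snd z) <= 1) /\
  forall z, ~ S z -> exists d, 0 < d /\ forall z', Rabs (fst z' - fst z) < d ->
    Rabs (snd z' - snd z) < d -> ~ S z'.

(** If the supremum [M] is not attained, every point of the box has a neighbourhood on which the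
    function stays below [M] by a definite gap. Compactness makes the gap uniform, and [M] is no
    longer the least upper bound. *)
Lemma max_attained (S : C -> Prop) (f : C -> R) :
  closed_in_unit_box S -> (exists z, S z) -> continuous_on S f ->
  exists z, S z /\ forall z', S z' -> f z' <= f z.
Proof.
  intros [Hb Hc] [z0 Sz0] Hf.
  apply NNPP. intros Hno.
  (* Composing with atan makes the function bounded at no cost. *)
  set (F := fun z => atan (f z)).
  destruct (completeness (fun m => exists z, S z /\ m = F z)) as [M [HM1 HM2]].
  { exists (PI / 2). intros m [z [_ ->]]. left. apply atan_bound. }
  { exists (F z0), z0. auto. }
  assert (Hlt : forall z, S z -> F z < M).
  { intros z Sz. apply Rnot_le_lt. intros Hle. apply Hno. exists z. split; [exact Sz|].
    intros z' Sz'. apply Rnot_lt_le. intros Hlt.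
    apply atan_increasing in Hlt. specialize (HM1 (F z') (ex_intro _ z' (conj Sz' eq_refl))).
    unfold F in *. lra. }
  (* One number serves both as radius of the neighbourhood and as gap below [M], so that a lower
     bound on the radii is also a lower bound on the gaps. Points outside [S] get a neighbourhood
     disjoint from [S]. *)
  assert (Hloc : forall x y, exists d : posreal, forall z', S z' ->
            Rabs (fst z' - x) < d -> Rabs (snd z' - y) < d -> F z' <= M - d).
  { intros x y. destruct (classic (S (x, y))) as [Sz|Sz].
    - assert (HF : continuous_on S F).
      { intros z Sz'. apply filterlim_comp with (1 := Hf z Sz').
        apply continuous_atan. }
      rewrite continuous_on_eps in HF.
      pose proof (Hlt _ Sz) as Hm.
      destruct (HF _ Sz ((M - F (x, y)) / 2)) as [d [Hd Hd']]; [lra|].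
      assert (Hm' : 0 < Rmin d ((M - F (x, y)) / 2)) by (apply Rmin_pos; lra).
      exists (mkposreal _ Hm'). simpl. intros z' Sz' H1 H2.
      pose proof (Rmin_l d ((M - F (x, y)) / 2)).
      pose proof (Rmin_r d ((M - F (x, y)) / 2)).
      specialize (Hd' z' Sz' ltac:(simpl; lra) ltac:(simpl; lra)).
      apply Rabs_def2 in Hd'. lra.
    - destruct (Hc _ Sz) as [d [Hd Hd']].
      exists (mkposreal d Hd). simpl. intros z' Sz' H1 H2. exfalso.
      apply (Hd' z'); assumption. }
  assert (Hd : exists delta : R -> R -> posreal, forall x y z', S z' ->
            Rabs (fst z' - x) < delta x y -> Rabs (snd z' - y) < delta x y ->
            F z' <= M - delta x y).
  { exists (fun x y => proj1_sig (constructive_indefinite_description _ (Hloc x y))).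
    intros x y. exact (proj2_sig (constructive_indefinite_description _ (Hloc x y))). }
  destruct Hd as [delta Hd].
  destruct (compactness_value_2d (-1) 1 (-1) 1 delta) as [d Hd'].
  assert (HM : M <= M - d).
  { apply HM2. intros m [z [Sz ->]]. destruct (Hb z Sz) as [H1 H2].
    apply Rabs_le_between in H1. apply Rabs_le_between in H2.
    destruct (NNPP _ (Hd' (fst z) (snd z) H1 H2)) as [p [q (_ & _ & H3 & H4 & H5)]].
    specialize (Hd p q z Sz H3 H4). lra. }
  pose proof (cond_pos d). lra.
Qed.

(** At the maximum [f'] vanishes. If [l] were positive, [f'] would be positive just to the right of
    [0], and the mean value theorem would give a larger value of [f] there. *)
Lemma local_max_second_derivative (f f' : R -> R) (l : R) :
  locally 0 (fun t => is_derive f t (f' t)) -> is_derive f' 0 l ->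
  locally 0 (fun t => f t <= f 0) -> l <= 0.
Proof.
  intros [d1 H1] H2 [d3 H3].
  assert (B : forall d t : R, Rabs t < d -> ball 0 d t).
  { intros d t Ht. change (Rabs (t - 0) < d). rewrite Rminus_0_r. exact Ht. }
  assert (H0 : f' 0 = 0).
  { specialize (H1 0 (ball_center _ _)).
    assert (pr : derivable_pt f 0) by (exists (f' 0); now apply is_derive_Reals).
    transitivity (derive_pt f 0 pr).
    { symmetry. apply derive_pt_eq_0. now apply is_derive_Reals. }
    apply (deriv_maximum f (- d3) d3).
    - pose proof (cond_pos d3). lra.
    - apply cond_pos.
    - intros x Hx1 Hx2. apply H3, B. now apply Rabs_def1. }
  apply Rnot_lt_le. intros Hl.
  apply is_derive_Reals in H2.
  (* With tolerance [l] the difference quotients of [f'] stay within [l] of [l], hence positive. *)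
  destruct (H2 l Hl) as [d2 Hd2].
  set (t := Rmin d1 (Rmin d2 d3) / 2).
  pose proof (cond_pos d1). pose proof (cond_pos d2). pose proof (cond_pos d3).
  assert (Ht : 0 < t /\ t < d1 /\ t < d2 /\ t < d3).
  { unfold t. pose proof (Rmin_l d1 (Rmin d2 d3)). pose proof (Rmin_r d1 (Rmin d2 d3)).
    pose proof (Rmin_l d2 d3). pose proof (Rmin_r d2 d3).
    assert (0 < Rmin d1 (Rmin d2 d3)) by (repeat apply Rmin_pos; assumption). lra. }
  destruct (MVT_cor2 f f' 0 t) as [c [Hc1 Hc2]]; [lra| |].
  { intros c Hc. apply is_derive_Reals, H1, B. rewrite Rabs_pos_eq; lra. }
  assert (Hc3 : 0 < f' c).
  { specialize (Hd2 c ltac:(lra) ltac:(rewrite Rabs_pos_eq; lra)).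
    rewrite Rplus_0_l, H0, Rminus_0_r in Hd2. apply Rabs_def2 in Hd2.
    assert (0 < f' c / c) by lra.
    replace (f' c) with (f' c / c * c) by (field; lra). nra. }
  assert (f t <= f 0) by (apply H3, B; rewrite Rabs_pos_eq; lra).
  nra.
Qed.

(* [A], [B], [D] encode the quadratic form [A a^2 + B a b + D b^2] of second
   directional derivatives, and [l] is its trace.  Asking for every direction
   makes the notion invariant under isometries without any chain rule. *)
Definition has_laplacian (f : C -> R) (z : C) (l : R) : Prop :=
  exists A B D, A + D = l /\ forall a b, exists f',
    locally 0 (fun t => is_derive (fun s => f (fst z + s * a, snd z + s * b)) t (f' t)) /\
    is_derive f' 0 (A * a ^ 2 + B * a * b + D * b ^ 2).

Lemma has_laplacian_local_max (f : C -> R) (z : C) (l d : R) :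
  has_laplacian f z l -> 0 < d ->
  (forall z', Rabs (fst z' - fst z) < d -> Rabs (snd z' - snd z) < d -> f z' <= f z) ->
  l <= 0.
Proof.
  intros (A & B & D & <- & H) Hd Hmax.
  assert (Hm : forall a b, a ^ 2 + b ^ 2 = 1 ->
            locally 0 (fun t => f (fst z + t * a, snd z + t * b)
                                <= f (fst z + 0 * a, snd z + 0 * b))).
  { intros a b Hab. exists (mkposreal d Hd). intros t Ht.
    change (Rabs (t - 0) < d) in Ht. rewrite Rminus_0_r in Ht.
    replace (fst z + 0 * a, snd z + 0 * b) with z
      by (destruct z; simpl; f_equal; ring).
    assert (Ha : Rabs a <= 1) by (apply Rabs_le; nra).
    assert (Hb : Rabs b <= 1) by (apply Rabs_le; nra).
    pose proof (Rabs_pos t).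
    apply Hmax; simpl.
    - replace (fst z + t * a - fst z) with (t * a) by ring. rewrite Rabs_mult. nra.
    - replace (snd z + t * b - snd z) with (t * b) by ring. rewrite Rabs_mult. nra. }
  (* The two coordinate directions isolate [A] and [D], whose sum is the trace. *)
  destruct (H 1 0) as [f1 [H1 H1']]. destruct (H 0 1) as [f2 [H2 H2']].
  assert (E1 := local_max_second_derivative _ _ _ H1 H1' (Hm 1 0 ltac:(ring))).
  assert (E2 := local_max_second_derivative _ _ _ H2 H2' (Hm 0 1 ltac:(ring))).
  lra.
Qed.

Lemma has_laplacian_plus (f g : C -> R) (z : C) (l m : R) :
  has_laplacian f z l -> has_laplacian g z m -> has_laplacian (fun z => f z + g z) z (l + m).
Proof.
  intros (A & B & D & <- & H) (A' & B' & D' & <- & H').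
  exists (A + A'), (B + B'), (D + D'). split; [ring|].
  intros a b. destruct (H a b) as [f' [H1 H2]]. destruct (H' a b) as [g' [H1' H2']].
  exists (fun t => f' t + g' t). split.
  - generalize (filter_and _ _ H1 H1'). apply filter_imp. intros t [Ht Ht'].
    apply @is_derive_plus; assumption.
  - replace ((A + A') * a ^ 2 + (B + B') * a * b + (D + D') * b ^ 2)
      with (plus (A * a ^ 2 + B * a * b + D * b ^ 2) (A' * a ^ 2 + B' * a * b + D' * b ^ 2))
      by (unfold plus; simpl; ring).
    apply @is_derive_plus; assumption.
Qed.

Lemma has_laplacian_scal (f : C -> R) (z : C) (l k : R) :
  has_laplacian f z l -> has_laplacian (fun z => k * f z) z (k * l).
Proof.
  intros (A & B & D & <- & H).
  exists (k * A), (k * B), (k * D). split; [ring|].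
  intros a b. destruct (H a b) as [f' [H1 H2]].
  exists (fun t => k * f' t). split.
  - generalize H1. apply filter_imp. intros t Ht. now apply is_derive_scal.
  - replace (k * A * a ^ 2 + k * B * a * b + k * D * b ^ 2)
      with (k * (A * a ^ 2 + B * a * b + D * b ^ 2)) by ring.
    now apply is_derive_scal.
Qed.

Definition harmonic_in_disk (f : C -> R) : Prop :=
  forall z, open_disk z -> has_laplacian f z 0.

(* [(c, s)] is a unit complex number; [e = -1] composes with a conjugation. *)
Lemma harmonic_in_disk_isometry (f : C -> R) (c s e : R) :
  c ^ 2 + s ^ 2 = 1 -> e ^ 2 = 1 -> harmonic_in_disk f ->
  harmonic_in_disk (fun z => f (c * fst z - s * (e * snd z), s * fst z + c * (e * snd z))).
Proof.
  intros Hcs He Hf [x y] Hz.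
  destruct (Hf (c * x - s * (e * y), s * x + c * (e * y))) as (A & B & D & HAD & H).
  { unfold open_disk, Cmod in *. simpl fst in *. simpl snd in *.
    replace ((c * x - s * (e * y)) ^ 2 + (s * x + c * (e * y)) ^ 2)
      with ((c ^ 2 + s ^ 2) * (x ^ 2 + e ^ 2 * y ^ 2)) by ring.
    now rewrite Hcs, He, !Rmult_1_l. }
  exists (A * c ^ 2 + B * c * s + D * s ^ 2),
    (e * (-2 * A * c * s + B * (c ^ 2 - s ^ 2) + 2 * D * c * s)),
    (A * s ^ 2 - B * c * s + D * c ^ 2).
  split.
  { replace 0 with (1 * (A + D)) by lra. rewrite <- Hcs. ring. }
  intros a b. destruct (H (c * a - s * (e * b)) (s * a + c * (e * b))) as [f' [H1 H2]].
  exists f'. split.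
  - generalize H1. apply filter_imp. intros t. apply is_derive_ext. intros u.
    simpl. f_equal. f_equal; ring.
  - match type of H2 with is_derive _ _ ?v => match goal with |- is_derive _ _ ?w =>
      replace w with v; [exact H2|] end end.
    replace (A * (c * a - s * (e * b)) ^ 2 + B * (c * a - s * (e * b)) * (s * a + c * (e * b)) +
      D * (s * a + c * (e * b)) ^ 2) with
      (A * (c^2 * a^2 - 2 * c * a * s * e * b + s^2 * (e^2) * b^2)
       + B * (c*s*a^2 + (c^2 - s^2) * a * e * b - s * c * (e^2) * b^2)
       + D * (s^2*a^2 + 2 * s * a * c * e * b + c^2*(e^2)*b^2)) by ring.
    rewrite He. ring.
Qed.

(** * Disks in the plane and differentiation along lines *)

Lemma Cmod_box (z z' : C) (d : R) :
  Rabs (fst z' - fst z) < d -> Rabs (snd z' - snd z) < d -> Cmod (z' - z)%C < 2 * d.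
Proof.
  intros H1 H2.
  apply Rle_lt_trans with (1 := Cmod_2Rmax _). simpl.
  change (sqrt 2 * Rmax (Rabs (fst z' - fst z)) (Rabs (snd z' - snd z)) < 2 * d).
  assert (Hm := Rmax_lub_lt _ _ _ H1 H2).
  assert (sqrt 2 < 2).
  { rewrite <- (sqrt_pow2 2) at 2 by lra. apply sqrt_lt_1; lra. }
  pose proof (Rmax_l (Rabs (fst z' - fst z)) (Rabs (snd z' - snd z))).
  pose proof (Rabs_pos (fst z' - fst z)).
  assert (0 <= sqrt 2) by apply sqrt_pos. nra.
Qed.

Lemma Cmod_le_plus (z z' : C) : Cmod z' <= Cmod z + Cmod (z' - z)%C.
Proof.
  replace z' with (z + (z' - z))%C at 1 by ring. apply Cmod_triangle.
Qed.

Lemma open_disk_box (z : C) : open_disk z -> exists d, 0 < d /\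
  forall z', Rabs (fst z' - fst z) < d -> Rabs (snd z' - snd z) < d -> open_disk z'.
Proof.
  unfold open_disk. intros Hz. exists ((1 - Cmod z) / 2). split; [lra|].
  intros z' H1 H2. pose proof (Cmod_box z z' _ H1 H2). pose proof (Cmod_le_plus z z'). lra.
Qed.

Lemma open_disk_locally (z : C) : open_disk z -> locally z open_disk.
Proof.
  intros Hz. destruct (open_disk_box z Hz) as [d [Hd H]].
  exists (mkposreal d Hd). intros z' [H1 H2]. now apply H.
Qed.

Lemma continuous_Cpair {T : UniformSpace} (f g : T -> R) (z : T) :
  continuous f z -> continuous g z -> continuous (fun z => (f z, g z) : C) z.
Proof.
  intros Hf Hg P [eps HP].
  assert (H1 : locally z (fun p => ball (f z) eps (f p))) by apply Hf, locally_ball.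
  assert (H2 : locally z (fun p => ball (g z) eps (g p))) by apply Hg, locally_ball.
  refine (filter_imp _ _ _ (filter_and _ _ H1 H2)).
  intros p [B1 B2]. apply HP. split; assumption.
Qed.

Lemma open_disk_line (z : C) (a b t : R) : open_disk (fst z + t * a, snd z + t * b) ->
  locally t (fun s => open_disk (fst z + s * a, snd z + s * b)).
Proof.
  intros Hz.
  assert (Hl : forall p q : R, continuous (fun s : R => p + s * q) t).
  { intros p q. apply @ex_derive_continuous. auto_derive. exact I. }
  exact (continuous_Cpair _ _ _ (Hl _ _) (Hl _ _) _ (open_disk_locally _ Hz)).
Qed.

Lemma closed_disk_closed_in_unit_box : closed_in_unit_box closed_disk.
Proof.
  unfold closed_disk. split.
  - intros z Hz. pose proof (Rmax_Cmod z).
    pose proof (Rmax_l (Rabs (fst z)) (Rabs (snd z))).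
    pose proof (Rmax_r (Rabs (fst z)) (Rabs (snd z))). lra.
  - intros z Hz. exists ((Cmod z - 1) / 2). split; [lra|].
    intros z' H1 H2. pose proof (Cmod_box z z' _ H1 H2). pose proof (Cmod_le_plus z' z).
    replace (z - z')%C with (- (z' - z))%C in * by ring. rewrite Cmod_opp in *. lra.
Qed.

Lemma half_disk_closed_in_unit_box :
  closed_in_unit_box (fun z => closed_disk z /\ 0 <= snd z).
Proof.
  destruct closed_disk_closed_in_unit_box as [Hb Hc]. split.
  - intros z [Hz _]. auto.
  - intros z Hz. destruct (classic (closed_disk z)) as [H|H].
    + exists (- snd z). split; [apply Rnot_le_lt; intros H'; apply Hz; split; [exact H|lra]|].
      intros z' _ H2 [_ H3]. apply Rabs_def2 in H2. lra.
    + destruct (Hc z H) as [d [Hd H']]. exists d. split; [exact Hd|].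
      intros z' H1 H2 [H3 _]. exact (H' z' H1 H2 H3).
Qed.

(** Continuity of a partial derivative yields the total differential, on which the chain rule along
    lines rests. *)
Lemma C1_on_differentiable (f : C -> R) (z : C) : C1_on open_disk f -> open_disk z ->
  differentiable_pt_lim (fun x y => f (x, y)) (fst z) (snd z) (dx f z) (dy f z).
Proof.
  intros Hf Hz. apply filterdiff_differentiable_pt_lim. destruct z as [x y].
  apply (is_derive_filterdiff (fun x y => f (x, y)) x y
                 (fun x y => dx f (x, y)) (dy f (x, y))).
  - generalize (open_disk_locally _ Hz). apply filter_imp. intros [p q] Hpq.
    apply Derive_correct. exact (proj1 (Hf (p, q) Hpq)).
  - apply Derive_correct. exact (proj1 (proj2 (Hf (x, y) Hz))).
  - destruct (Hf (x, y) Hz) as (_ & _ & H & _). revert H.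
    apply continuous_ext. intros [p q]. reflexivity.
Qed.

Lemma C1_on_line (f : C -> R) (z : C) (a b t : R) : C1_on open_disk f ->
  open_disk (fst z + t * a, snd z + t * b) ->
  is_derive (fun s => f (fst z + s * a, snd z + s * b)) t
    (dx f (fst z + t * a, snd z + t * b) * a + dy f (fst z + t * a, snd z + t * b) * b).
Proof.
  intros Hf Hz. apply is_derive_Reals.
  apply (derivable_pt_lim_comp_2d (fun x y => f (x, y))
           (fun s => fst z + s * a) (fun s => snd z + s * b)).
  - apply C1_on_differentiable with (z := (fst z + t * a, snd z + t * b)); assumption.
  - apply is_derive_Reals. auto_derive; [exact I|ring].
  - apply is_derive_Reals. auto_derive; [exact I|ring].
Qed.

Lemma harmonic_on_harmonic_in_disk (f : C -> R) :
  harmonic_on open_disk f -> harmonic_in_disk f.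
Proof.
  intros [[H0 [H1 H2]] Hl] z Hz.
  (* The middle coefficient collects both mixed derivatives, one from each term of the directional
     derivative. *)
  exists (dx (dx f) z), (dy (dx f) z + dx (dy f) z), (dy (dy f) z).
  split; [exact (Hl z Hz)|]. intros a b.
  exists (fun t => dx f (fst z + t * a, snd z + t * b) * a
                   + dy f (fst z + t * a, snd z + t * b) * b).
  assert (Hz0 : z = (fst z + 0 * a, snd z + 0 * b))
    by (destruct z; simpl; f_equal; ring).
  assert (Hz' := Hz). rewrite Hz0 in Hz'.
  split.
  - generalize (open_disk_line z a b 0 Hz'). apply filter_imp. intros t Ht.
    now apply C1_on_line.
  - assert (D1 := C1_on_line _ z a b 0 H1 Hz').
    assert (D2 := C1_on_line _ z a b 0 H2 Hz').
    rewrite <- Hz0 in D1, D2.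
    replace (dx (dx f) z * a ^ 2 + (dy (dx f) z + dx (dy f) z) * a * b + dy (dy f) z * b ^ 2)
      with (plus (a * (dx (dx f) z * a + dy (dx f) z * b))
                 (b * (dx (dy f) z * a + dy (dy f) z * b))) by (unfold plus; simpl; ring).
    apply (is_derive_plus (fun t => dx f (fst z + t * a, snd z + t * b) * a)
             (fun t => dy f (fst z + t * a, snd z + t * b) * b)).
    + apply is_derive_ext with (fun t => a * dx f (fst z + t * a, snd z + t * b)).
      { intros t. apply Rmult_comm. }
      now apply is_derive_scal.
    + apply is_derive_ext with (fun t => b * dy f (fst z + t * a, snd z + t * b)).
      { intros t. apply Rmult_comm. }
      now apply is_derive_scal.
Qed.

(** One family for two purposes: [p = 0], [q = r] is the perturbation by a multiple of the squared
    modulus in the weak maximum principle, and [q = 0] with negative [p] is the barrier of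
    [conj_le]. *)
Lemma has_laplacian_quadratic (p q r : R) (z : C) :
  has_laplacian (fun z => p * snd z + (q * fst z ^ 2 + r * snd z ^ 2)) z (2 * q + 2 * r).
Proof.
  exists (2 * q), 0, (2 * r). split; [reflexivity|]. intros a b.
  exists (fun t => p * b + (q * (2 * (fst z + t * a) * a) + r * (2 * (snd z + t * b) * b))).
  split.
  - apply filter_forall. intros t. simpl. auto_derive; [exact I|ring].
  - auto_derive; [exact I|ring].
Qed.

Lemma continuous_on_plus (S : C -> Prop) (f g : C -> R) :
  continuous_on S f -> continuous_on S g -> continuous_on S (fun z => f z + g z).
Proof.
  intros Hf Hg z Sz.
  apply (filterlim_comp_2 f g Rplus (Hf z Sz) (Hg z Sz)).
  apply (filterlim_plus (f z) (g z)).
Qed.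

Lemma continuous_on_comp (S T : C -> Prop) (f : C -> R) (h : C -> C) :
  (forall z, S z -> T (h z)) -> (forall z, continuous h z) ->
  continuous_on T f -> continuous_on S (fun z => f (h z)).
Proof.
  intros HST Hh Hf z Sz P HP.
  specialize (Hf (h z) (HST z Sz) P HP).
  assert (Hz := Hh z (fun w => T w -> P (f w)) Hf). unfold filtermap, within in *.
  revert Hz. apply filter_imp. intros z' H Sz'. apply H, HST, Sz'.
Qed.

Lemma continuous_on_quadratic (S : C -> Prop) (p q r : R) :
  continuous_on S (fun z : C => p * snd z + (q * fst z ^ 2 + r * snd z ^ 2)).
Proof.
  apply continuous_on_forall. intros z _.
  assert (H1 : continuous (fst : C -> R) z) by apply continuous_fst.
  assert (H2 : continuous (snd : C -> R) z) by apply continuous_snd.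
  assert (Hm : forall f g : C -> R, continuous f z -> continuous g z ->
     continuous (fun z => f z * g z) z).
  { intros f g Hf Hg. apply (continuous_mult f g); assumption. }
  assert (Hk : forall k : R, continuous (fun _ : C => k) z) by (intros; apply continuous_const).
  assert (Hp : forall f g : C -> R, continuous f z -> continuous g z ->
     continuous (fun z => f z + g z) z).
  { intros f g Hf Hg. apply (continuous_plus f g); assumption. }
  simpl. repeat (apply Hp || apply Hm); auto.
Qed.

(** Adding [eps] times the squared modulus makes the Laplacian positive, which excludes an interior
    maximum. *)
Lemma weak_maximum_principle (f : C -> R) (c : R) :
  harmonic_in_disk f -> continuous_on closed_disk f ->
  (forall z, Cmod z = 1 -> f z <= c) -> forall z, closed_disk z -> f z <= c.
Proof.
  intros Hf Hc Hb z Hz. apply Rnot_lt_le. intros Hlt.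
  (* Half of the excess: on the circle [F] is at most [c + eps], still below [f z], hence below
     [F z]. *)
  set (eps := (f z - c) / 2).
  set (F := fun z : C => f z + (0 * snd z + (eps * fst z ^ 2 + eps * snd z ^ 2))).
  destruct (max_attained closed_disk F) as [z0 [Hz0 Hmax]].
  { exact closed_disk_closed_in_unit_box. }
  { now exists z. }
  { apply continuous_on_plus; [exact Hc|apply continuous_on_quadratic]. }
  assert (Hle := Hmax z Hz). unfold F in Hle.
  assert (HC0 : Cmod z0 ^ 2 = fst z0 ^ 2 + snd z0 ^ 2) by apply Cmod2_alt.
  destruct (Rle_lt_or_eq_dec _ _ Hz0) as [H1|H1].
  - destruct (open_disk_box z0 H1) as [d [Hd Hbox]].
    assert (Hl : 0 + (2 * eps + 2 * eps) <= 0).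
    { apply (has_laplacian_local_max F z0 _ d).
      - apply has_laplacian_plus; [now apply Hf|apply has_laplacian_quadratic].
      - exact Hd.
      - intros z' Hx Hy. apply Hmax. left. now apply Hbox. }
    unfold eps in Hl. lra.
  - specialize (Hb z0 H1). rewrite H1 in HC0.
    assert (0 <= fst z ^ 2 + snd z ^ 2) by nra.
    unfold eps in Hle. nra.
Qed.

Lemma harmonic_unique (f g : C -> R) :
  harmonic_in_disk f -> harmonic_in_disk g ->
  continuous_on closed_disk f -> continuous_on closed_disk g ->
  (forall z, Cmod z = 1 -> f z = g z) -> forall z, closed_disk z -> f z = g z.
Proof.
  assert (H : forall f g, harmonic_in_disk f -> harmonic_in_disk g ->
    continuous_on closed_disk f -> continuous_on closed_disk g ->
    (forall z, Cmod z = 1 -> f z = g z) -> forall z, closed_disk z -> f z <= g z).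
  { clear. intros f g Hf Hg Cf Cg E z Hz.
    enough (f z + -1 * g z <= 0) by lra.
    apply (weak_maximum_principle (fun z => f z + -1 * g z)); [| | |exact Hz].
    - intros p Hp. replace 0 with (0 + -1 * 0) by ring.
      apply has_laplacian_plus; [|apply has_laplacian_scal]; auto.
    - apply continuous_on_plus; [exact Cf|]. intros p Hp.
      apply (filterlim_comp _ _ _ g (fun t => -1 * t) _ _ _ (Cg p Hp)).
      apply (filterlim_scal_r (-1) (g p)).
    - intros p Hp. rewrite (E p Hp). lra. }
  intros Hf Hg Cf Cg E z Hz. apply Rle_antisym; apply H; auto.
  intros p Hp. now rewrite E.
Qed.

(** * Uniqueness for the Neumann problem *)

Lemma has_laplacian_ext (f g : C -> R) (z : C) (l : R) :
  (forall z, f z = g z) -> has_laplacian f z l -> has_laplacian g z l.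
Proof.
  intros E (A & B & D & HAD & H). exists A, B, D. split; [exact HAD|].
  intros a b. destruct (H a b) as [f' [H1 H2]]. exists f'. split; [|exact H2].
  generalize H1. apply filter_imp. intros t. apply is_derive_ext. intros s. apply E.
Qed.

Lemma Cmod_le_1 (z : C) : Cmod z <= 1 <-> fst z ^ 2 + snd z ^ 2 <= 1.
Proof.
  unfold Cmod. split; intros H.
  - rewrite <- (pow2_sqrt (fst z ^ 2 + snd z ^ 2)) by nra.
    pose proof (sqrt_pos (fst z ^ 2 + snd z ^ 2)). nra.
  - rewrite <- sqrt_1. now apply sqrt_le_1_alt.
Qed.

Lemma Cmod_eq_1 (z : C) : Cmod z = 1 <-> fst z ^ 2 + snd z ^ 2 = 1.
Proof.
  unfold Cmod. split; intros H.
  - rewrite <- (pow2_sqrt (fst z ^ 2 + snd z ^ 2)) by nra. rewrite H. ring.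
  - rewrite H. apply sqrt_1.
Qed.

Lemma Cmod_lt_1 (z : C) : Cmod z < 1 <-> fst z ^ 2 + snd z ^ 2 < 1.
Proof.
  unfold Cmod. split; intros H.
  - rewrite <- (pow2_sqrt (fst z ^ 2 + snd z ^ 2)) by nra.
    pose proof (sqrt_pos (fst z ^ 2 + snd z ^ 2)). nra.
  - rewrite <- sqrt_1. apply sqrt_lt_1_alt. nra.
Qed.

Lemma unit_polar (x y : R) : x ^ 2 + y ^ 2 = 1 -> exists t, x = cos t /\ y = sin t.
Proof.
  intros H. assert (Hx : -1 <= x <= 1) by nra.
  assert (Hs : sin (acos x) = Rabs y).
  { rewrite sin_acos by exact Hx. rewrite <- sqrt_Rsqr_abs. f_equal. unfold Rsqr. nra. }
  destruct (Rle_dec 0 y) as [Hy|Hy].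
  - exists (acos x). rewrite cos_acos, Hs, Rabs_pos_eq by assumption. auto.
  - exists (- acos x). rewrite cos_neg, sin_neg, cos_acos, Hs, Rabs_left by lra. lra.
Qed.

(** Points of the circle are given by their coordinates rather than by an angle, so that the
    condition passes to rotated functions by polynomial identities. *)
Definition zero_flux (w : C -> R) : Prop :=
  forall x y, x ^ 2 + y ^ 2 = 1 ->
    filterlim (fun s => (w (s * x, s * y) - w (x, y)) / (s - 1)) (at_left 1) (locally 0).

Lemma zero_flux_eps (w : C -> R) (x y eps : R) : zero_flux w -> x ^ 2 + y ^ 2 = 1 ->
  0 < eps -> at_left 1 (fun s => Rabs ((w (s * x, s * y) - w (x, y)) / (s - 1)) < eps).
Proof.
  intros Hw Hxy He. apply (Hw x y Hxy (fun v => Rabs v < eps)).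
  exists (mkposreal eps He). intros v Hv. change (Rabs (v - 0) < eps) in Hv.
  now rewrite Rminus_0_r in Hv.
Qed.

(* The barrier [- y + y ^ 2 / 4] is strictly subharmonic, vanishes on the real
   axis and has a negative normal derivative on the upper half circle, so that
   [w z - w (conj z)] plus a multiple of it can only be maximal on the real
   axis. *)
Lemma conj_le (w : C -> R) :
  harmonic_in_disk w -> continuous_on closed_disk w -> zero_flux w ->
  forall z, closed_disk z -> 0 <= snd z -> w z <= w (fst z, - snd z).
Proof.
  intros Hh Hc Hf z Hz Hy. apply Rnot_lt_le. intros Hlt.
  set (e := w z - w (fst z, - snd z)).
  assert (He : 0 < e) by (unfold e; lra).
  set (F := fun z : C => (w z + -1 * w (fst z, - snd z))
                  + (- e * snd z + (0 * fst z ^ 2 + e / 4 * snd z ^ 2))).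
  assert (Hconj : forall z : C, closed_disk z -> closed_disk (fst z, - snd z)).
  { unfold closed_disk. intros p. rewrite !Cmod_le_1. simpl fst. simpl snd.
    replace ((- snd p) ^ 2) with (snd p ^ 2) by ring. auto. }
  destruct (max_attained (fun z => closed_disk z /\ 0 <= snd z) F) as [[x0 y0] [[Hz0 Hy0] Hmax]].
  { exact half_disk_closed_in_unit_box. }
  { exists z. auto. }
  { apply continuous_on_plus; [|apply continuous_on_quadratic].
    apply continuous_on_plus.
    - apply (continuous_on_subset closed_disk); [tauto|exact Hc].
    - apply (continuous_on_comp _ closed_disk (fun z => -1 * w z) (fun z => (fst z, - snd z))).
      + intros p [Hp _]. now apply Hconj.
      + intros p. apply (continuous_Cpair (fst : C -> R) (fun z : C => - snd z)).
        * apply continuous_fst.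
        * apply (continuous_opp (snd : C -> R)). apply continuous_snd.
      + intros p Hp.
        apply (filterlim_comp _ _ _ w (fun t => -1 * t) _ _ _ (Hc p Hp)).
        apply (filterlim_scal_r (-1) (w p)). }
  simpl in Hy0.
  (* At [z] the difference equals [e], so [F z] is [e * (1 - snd z / 2) ^ 2]. The coefficient
     [1 / 4] of the barrier completes this square. *)
  assert (HF : 0 < F z).
  { unfold F. assert (snd z <= 1).
    { assert (H := proj1 (Cmod_le_1 z) Hz). nra. }
    replace (w z + -1 * w (fst z, - snd z)) with e by (unfold e; ring).
    assert (0 < e * (1 - snd z / 2) ^ 2)
      by (apply Rmult_lt_0_compat; [|apply pow_lt]; lra). lra. }
  specialize (Hmax z (conj Hz Hy)) as Hmax0.
  destruct (Rle_lt_or_eq_dec _ _ Hy0) as [Hy1|Hy1].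
  2: { subst y0. assert (F (x0, 0) = 0); [|lra]. unfold F. simpl.
       rewrite Ropp_0. ring. }
  destruct (Rle_lt_or_eq_dec _ _ Hz0) as [Hz1|Hz1].
  - destruct (open_disk_box _ Hz1) as [d [Hd Hbox]].
    (* At an interior point above the axis the Laplacian of [F] is [e / 2 > 0]. The radius
       [Rmin d y0] keeps the box inside the half disk, where [F] is known to be maximal. *)
    assert (Hl : (0 + -1 * 0) + (2 * 0 + 2 * (e / 4)) <= 0).
    { apply (has_laplacian_local_max F (x0, y0) _ (Rmin d y0)).
      - apply has_laplacian_plus; [|apply has_laplacian_quadratic].
        apply has_laplacian_plus; [now apply Hh|]. apply has_laplacian_scal.
        apply (has_laplacian_ext
          (fun z => w (1 * fst z - 0 * (-1 * snd z), 0 * fst z + 1 * (-1 * snd z)))).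
        { intros p. f_equal. f_equal; ring. }
        apply (harmonic_in_disk_isometry w 1 0 (-1)); [ring|ring|exact Hh|exact Hz1].
      - now apply Rmin_pos.
      - intros z' H1 H2. pose proof (Rmin_l d y0). pose proof (Rmin_r d y0).
        apply Hmax. split.
        + left. apply Hbox; lra.
        + simpl in H2. apply Rabs_def2 in H2. lra. }
    lra.
  - apply Cmod_eq_1 in Hz1. simpl fst in Hz1. simpl snd in Hz1.
    (* Near the circle the radial slope of the barrier is at most [- e * y0 / 2], because
       [y0 ^ 2 <= y0]. Two flux errors of [e * y0 / 8] cannot compensate it, so [F] would increase
       when moving inwards. *)
    assert (He8 : 0 < e * y0 / 8) by nra.
    assert (L1 := zero_flux_eps w x0 y0 _ Hf Hz1 He8).
    assert (Hz1' : x0 ^ 2 + (- y0) ^ 2 = 1) by (rewrite <- Hz1; ring).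
    assert (L2 := zero_flux_eps w x0 (- y0) _ Hf Hz1' He8).
    destruct (filter_and _ _ L1 L2) as [d Hd].
    pose proof (cond_pos d).
    set (s := Rmax (1 - d / 2) (1 / 2)).
    assert (Hs : 1 - d < s /\ 0 < s < 1).
    { unfold s. pose proof (Rmax_l (1 - d / 2) (1 / 2)). pose proof (Rmax_r (1 - d / 2) (1 / 2)).
      assert (Rmax (1 - d / 2) (1 / 2) < 1) by (apply Rmax_lub_lt; lra). lra. }
    destruct (Hd s) as [D1 D2].
    { change (Rabs (s - 1) < d). apply Rabs_def1; lra. }
    { lra. }
    apply Rabs_def2 in D1. apply Rabs_def2 in D2.
    assert (Hm : F (s * x0, s * y0) <= F (x0, y0)).
    { apply Hmax. split; [|simpl; nra].
      apply Cmod_le_1. simpl fst. simpl snd.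
      replace ((s * x0) ^ 2 + (s * y0) ^ 2) with (s ^ 2 * (x0 ^ 2 + y0 ^ 2)) by ring.
      rewrite Hz1. nra. }
    unfold F in Hm. simpl fst in Hm. simpl snd in Hm.
    replace (- (s * y0)) with (s * - y0) in Hm by ring.
    set (p := w (s * x0, s * y0) - w (x0, y0)) in *.
    set (q := w (s * x0, s * - y0) - w (x0, - y0)) in *.
    assert (P1 : p / (s - 1) * (s - 1) = p) by (field; lra).
    assert (P2 : q / (s - 1) * (s - 1) = q) by (field; lra).
    assert (Hm' : p - q + (s - 1) * (- e * y0 + (s + 1) * (e / 4) * y0 ^ 2) <= 0)
      by (unfold p, q; nra).
    rewrite <- P1, <- P2 in Hm'.
    assert (Hk : 0 <= p / (s - 1) - q / (s - 1) + (- e * y0 + (s + 1) * (e / 4) * y0 ^ 2)).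
    { apply Rnot_lt_le. intros Hk. nra. }
    assert (Hy2 : y0 <= 1) by nra.
    assert (y0 ^ 2 <= y0) by nra.
    assert ((s + 1) * (e / 4) * y0 ^ 2 <= e / 2 * y0).
    { apply Rle_trans with (2 * (e / 4) * y0); [|lra].
      apply Rmult_le_compat; nra. }
    nra.
Qed.

Lemma harmonic_in_disk_opp (w : C -> R) :
  harmonic_in_disk w -> harmonic_in_disk (fun z => -1 * w z).
Proof.
  intros H z Hz. replace 0 with (-1 * 0) by ring. now apply has_laplacian_scal, H.
Qed.

Lemma continuous_on_opp (S : C -> Prop) (w : C -> R) :
  continuous_on S w -> continuous_on S (fun z => -1 * w z).
Proof.
  intros Hc p Hp.
  apply (filterlim_comp _ _ _ w (fun t => -1 * t) _ _ _ (Hc p Hp)).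
  apply (filterlim_scal_r (-1) (w p)).
Qed.

(** [conj_le] for [w] and for [- w] gives both inequalities above the axis; below it the two points
    exchange their roles. *)
Lemma conj_eq (w : C -> R) :
  harmonic_in_disk w -> continuous_on closed_disk w -> zero_flux w ->
  forall x y, closed_disk (x, y) -> w (x, y) = w (x, - y).
Proof.
  intros Hh Hc Hf.
  assert (Hf' : zero_flux (fun z => -1 * w z)).
  { intros x y Hxy.
    apply filterlim_ext with (fun s => -1 * ((w (s * x, s * y) - w (x, y)) / (s - 1))).
    { intros s. unfold Rdiv. ring. }
    replace 0 with (-1 * 0) by ring.
    apply (filterlim_comp _ _ _ _ (fun t => -1 * t) _ _ _ (Hf x y Hxy)).
    apply (filterlim_scal_r (-1) 0). }
  assert (H : forall x y, closed_disk (x, y) -> 0 <= y -> w (x, y) = w (x, - y)).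
  { intros x y Hxy Hy. apply Rle_antisym.
    - exact (conj_le w Hh Hc Hf (x, y) Hxy Hy).
    - assert (E := conj_le _ (harmonic_in_disk_opp w Hh) (continuous_on_opp _ w Hc) Hf' (x, y) Hxy Hy).
      simpl in E. lra. }
  intros x y Hxy. destruct (Rle_dec 0 y) as [Hy|Hy]; [now apply H|].
  rewrite (H x (- y)); [now rewrite Ropp_involutive| |lra].
  unfold closed_disk in *. rewrite Cmod_le_1 in *. simpl fst in *. simpl snd in *.
  replace ((- y) ^ 2) with (y ^ 2) by ring. exact Hxy.
Qed.

(** The points [cis t] and [1] are mirror images in the line of angle [t / 2]. Rotating by [t / 2]
    turns this line into the real axis, so [conj_eq] makes [w] constant on the circle, and
    uniqueness for the Dirichlet problem extends this to the disk. *)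
Lemma neumann_unique (w : C -> R) :
  harmonic_in_disk w -> continuous_on closed_disk w -> zero_flux w ->
  forall z, closed_disk z -> w z = w (1, 0).
Proof.
  intros Hh Hc Hf.
  assert (Hcirc : forall t, w (cos t, sin t) = w (1, 0)).
  { intros t. set (c := cos (t / 2)). set (s := sin (t / 2)).
    assert (Hcs : c ^ 2 + s ^ 2 = 1).
    { unfold c, s. rewrite <- (sin2_cos2 (t / 2)). unfold Rsqr. ring. }
    set (v := fun z : C => w (c * fst z - s * (1 * snd z), s * fst z + c * (1 * snd z))).
    assert (Hv : v (c, s) = v (c, - s)).
    { apply conj_eq.
      - apply harmonic_in_disk_isometry; [exact Hcs|ring|exact Hh].
      - apply (continuous_on_comp _ closed_disk w
          (fun z => (c * fst z - s * (1 * snd z), s * fst z + c * (1 * snd z)))).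
        + intros z. unfold closed_disk. rewrite !Cmod_le_1. simpl fst. simpl snd.
          intros Hz. replace ((c * fst z - s * (1 * snd z)) ^ 2 + (s * fst z + c * (1 * snd z)) ^ 2)
            with ((c ^ 2 + s ^ 2) * (fst z ^ 2 + snd z ^ 2)) by ring. rewrite Hcs. lra.
        + intros z.
          assert (H1 : continuous (fst : C -> R) z) by apply continuous_fst.
          assert (H2 : continuous (snd : C -> R) z) by apply continuous_snd.
          assert (Hl : forall a b : R, continuous (fun z : C => a * fst z + b * snd z) z).
          { intros a b. apply (continuous_plus (fun z : C => a * fst z) (fun z : C => b * snd z)).
            - now apply (continuous_scal_r a (fst : C -> R)).
            - now apply (continuous_scal_r b (snd : C -> R)). }
          apply continuous_ext with (fun z : C => (c * fst z + - s * snd z, s * fst z + c * snd z)).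
          { intros p. f_equal; ring. }
          apply (continuous_Cpair (fun z : C => c * fst z + - s * snd z)
                   (fun z : C => s * fst z + c * snd z)); apply Hl.
        + exact Hc.
      - intros x y Hxy. unfold v. simpl fst. simpl snd.
        assert (E : (c * x - s * (1 * y)) ^ 2 + (s * x + c * (1 * y)) ^ 2 = 1).
        { transitivity ((c ^ 2 + s ^ 2) * (x ^ 2 + y ^ 2)); [ring|].
          rewrite Hcs, Hxy. ring. }
        generalize (Hf _ _ E). apply filterlim_ext. intros u.
        f_equal. f_equal. f_equal. f_equal; ring.
      - apply Cmod_le_1. simpl fst. simpl snd. lra. }
    unfold v in Hv. simpl fst in Hv. simpl snd in Hv.
    replace (cos t, sin t) with (c * c - s * (1 * s), s * c + c * (1 * s)).
    - rewrite Hv. f_equal. f_equal; [transitivity (c ^ 2 + s ^ 2); [ring|exact Hcs]|ring].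
    - replace t with (2 * (t / 2)) by field.
      rewrite cos_2a, sin_2a. unfold c, s. f_equal; ring. }
  assert (Hunit : forall z, Cmod z = 1 -> w z = w (1, 0)).
  { intros [x y] Hz. apply Cmod_eq_1 in Hz. simpl in Hz.
    destruct (unit_polar x y) as [t [-> ->]]; [simpl; lra|]. apply Hcirc. }
  intros z Hz.
  apply (harmonic_unique w (fun _ => w (1, 0))); auto.
  - intros p Hp. exists 0, 0, 0. split; [ring|]. intros a b. exists (fun _ => 0).
    split; [apply filter_forall; intros t; apply @is_derive_const|].
    replace (0 * a ^ 2 + 0 * a * b + 0 * b ^ 2) with 0 by ring. apply @is_derive_const.
  - apply continuous_on_forall. intros p _. apply continuous_const.
Qed.

(** * Logarithmic potential and Poisson integral *)

(* Coquelicot leaves equations at carriers that [ring] and [field] do not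
   recognize as [R]. *)
Ltac eq_R := match goal with |- ?p = ?q => change (@eq R p q) end.
Ltac ring_R := eq_R; unfold Rdiv; ring.

(** The weight [h] is separated from the kernel because it is merely continuous: all smoothness
    needed to differentiate under the integral is asked of the explicit kernel [k]. *)
Lemma is_derive_RInt_weighted (k k' : R -> R -> R) (h : R -> R) (a b t0 : R) :
  (forall tau, continuous h tau) ->
  locally t0 (fun t => forall tau,
    is_derive (fun s => k s tau) t (k' t tau) /\ continuous (k t) tau) ->
  (forall tau, continuity_2d_pt k' t0 tau) ->
  is_derive (fun t => RInt (fun tau => k t tau * h tau) a b) t0
    (RInt (fun tau => k' t0 tau * h tau) a b).
Proof.
  intros Hh Hk Hk'.
  assert (Hd : locally t0 (fun t => forall tau,
     is_derive (fun s => k s tau * h tau) t (k' t tau * h tau))).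
  { generalize Hk. apply filter_imp. intros t Ht tau. destruct (Ht tau) as [H _].
    apply is_derive_ext with (fun s => h tau * k s tau); [intros s; apply Rmult_comm|].
    rewrite Rmult_comm. now apply is_derive_scal. }
  rewrite (RInt_ext _ (fun tau => Derive (fun u => k u tau * h tau) t0)).
  2: { intros tau _. symmetry. apply is_derive_unique, (locally_singleton _ _ Hd). }
  apply is_derive_RInt_param.
  - generalize Hd. apply filter_imp. intros t Ht tau _. eexists. apply Ht.
  - intros tau _. apply continuity_2d_pt_ext_loc with (fun u v => k' u v * h v).
    + destruct Hd as [d Hd]. exists d. intros u v Hu _. symmetry.
      apply is_derive_unique, Hd, Hu.
    + apply continuity_2d_pt_mult; [apply Hk'|].
      apply (continuity_1d_2d_pt_comp h (fun _ v => v)); [|apply continuity_2d_pt_id2].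
      apply continuity_pt_filterlim, Hh.
  - generalize Hk. apply filter_imp. intros t Ht. apply @ex_RInt_continuous. intros tau _.
    apply (continuous_mult (k t) h); [apply Ht|apply Hh].
Qed.

Definition sq_dist (z : C) (tau : R) : R := (fst z - cos tau) ^ 2 + (snd z - sin tau) ^ 2.

Lemma Cmod_sub_cis (z : C) (tau : R) : Cmod (z - cis tau)%C = sqrt (sq_dist z tau).
Proof. reflexivity. Qed.

Lemma sq_dist_ge (z : C) (tau : R) : open_disk z -> (1 - Cmod z) ^ 2 <= sq_dist z tau.
Proof.
  unfold open_disk. intros Hz.
  assert (H : 1 - Cmod z <= Cmod (z - cis tau)%C).
  { assert (E : Cmod (cis tau) = 1).
    { apply Cmod_eq_1. simpl fst. simpl snd. rewrite <- (sin2_cos2 tau). unfold Rsqr. ring. }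
    pose proof (Cmod_le_plus z (cis tau)) as H. rewrite E in H.
    replace (cis tau - z)%C with (- (z - cis tau))%C in H by ring. rewrite Cmod_opp in H. lra. }
  rewrite Cmod_sub_cis in H.
  assert (H0 : 0 <= sq_dist z tau) by (unfold sq_dist; apply Rplus_le_le_0_compat; apply pow2_ge_0).
  rewrite <- (pow2_sqrt _ H0). apply pow_incr. lra.
Qed.

Lemma sq_dist_pos (z : C) (tau : R) : open_disk z -> 0 < sq_dist z tau.
Proof.
  intros Hz. apply Rlt_le_trans with (2 := sq_dist_ge z tau Hz).
  apply pow_lt. unfold open_disk in Hz. lra.
Qed.

(** A common shape for the kernels to be integrated: [p] alone with [n = 1] gives the Poisson
    kernel, [q] and [r] with [n = 1] the gradient of the logarithm, [e] and [f] with [n = 2] its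
    second derivatives. *)
Lemma continuous_kernel (p q r e f : R) (z : C) (n : nat) (tau : R) : open_disk z ->
  continuous (fun tau => (p + q * (fst z - cos tau) + r * (snd z - sin tau)
     + e * ((fst z - cos tau) * (snd z - sin tau))
     + f * ((snd z - sin tau) ^ 2 - (fst z - cos tau) ^ 2)) / sq_dist z tau ^ n) tau.
Proof.
  intros Hz. apply @ex_derive_continuous. unfold sq_dist. auto_derive.
  apply pow_nonzero. apply Rgt_not_eq. exact (sq_dist_pos z tau Hz).
Qed.

Lemma continuity_2d_pt_cos (x y : R) : continuity_2d_pt (fun _ v => cos v) x y.
Proof.
  apply (continuity_1d_2d_pt_comp cos (fun _ v => v)); [apply continuity_cos|].
  apply continuity_2d_pt_id2.
Qed.

Lemma continuity_2d_pt_sin (x y : R) : continuity_2d_pt (fun _ v => sin v) x y.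
Proof.
  apply (continuity_1d_2d_pt_comp sin (fun _ v => v)); [apply continuity_sin|].
  apply continuity_2d_pt_id2.
Qed.

Ltac continuity_2d := simpl; repeat first
  [ apply continuity_2d_pt_const | apply continuity_2d_pt_id1
  | apply continuity_2d_pt_cos | apply continuity_2d_pt_sin
  | apply continuity_2d_pt_minus | apply continuity_2d_pt_plus | apply continuity_2d_pt_mult ].

Lemma continuity_2d_kernel (f : R -> R -> R) (x y a b t tau : R) (n : nat) :
  open_disk (x + t * a, y + t * b) -> continuity_2d_pt f t tau ->
  continuity_2d_pt (fun t tau => f t tau / sq_dist (x + t * a, y + t * b) tau ^ n) t tau.
Proof.
  intros Hz Hf.
  assert (HD : continuity_2d_pt (fun u v => sq_dist (x + u * a, y + u * b) v) t tau).
  { unfold sq_dist. continuity_2d. }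
  apply continuity_2d_pt_mult; [exact Hf|]. apply continuity_2d_pt_inv.
  - induction n; [apply (continuity_2d_pt_const t tau 1)|].
    simpl. now apply continuity_2d_pt_mult.
  - apply pow_nonzero. apply Rgt_not_eq, sq_dist_pos, Hz.
Qed.

(* The derivative in the direction [(a, b)] of the integral of
   [ln (Cmod (z - cis tau)) * h tau]. *)
Definition grad_log (h : R -> R) (a b : R) (z : C) : R :=
  RInt (fun tau => (a * (fst z - cos tau) + b * (snd z - sin tau)) / sq_dist z tau * h tau)
    (- PI) PI.

Lemma ex_RInt_kernel (p q r e f : R) (h : R -> R) (z : C) (n : nat) :
  open_disk z -> (forall tau, continuous h tau) ->
  ex_RInt (fun tau => (p + q * (fst z - cos tau) + r * (snd z - sin tau)
     + e * ((fst z - cos tau) * (snd z - sin tau))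
     + f * ((snd z - sin tau) ^ 2 - (fst z - cos tau) ^ 2)) / sq_dist z tau ^ n * h tau) (- PI) PI.
Proof.
  intros Hz Hh. apply @ex_RInt_continuous. intros tau _.
  apply (continuous_mult (fun tau => (p + q * (fst z - cos tau) + r * (snd z - sin tau)
     + e * ((fst z - cos tau) * (snd z - sin tau))
     + f * ((snd z - sin tau) ^ 2 - (fst z - cos tau) ^ 2)) / sq_dist z tau ^ n) h);
    [now apply continuous_kernel|apply Hh].
Qed.

(** [S] and [T] integrate the second derivatives of the logarithm in [xx] and [xy]; the one in [yy]
    is the opposite of the one in [xx], whence [al * a - be * b]. The direction [(al, be)] is
    independent of the direction of differentiation because the Poisson integral needs
    [(al, be) = (- b, a)]. *)
Lemma is_derive_grad_log (h : R -> R) (z : C) :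
  open_disk z -> (forall tau, continuous h tau) -> exists S T, forall al be a b,
  is_derive (fun t => grad_log h al be (fst z + t * a, snd z + t * b)) 0
    ((al * a - be * b) * S + (al * b + be * a) * T).
Proof.
  intros Hz Hh.
  exists (RInt (fun tau => ((snd z - sin tau) ^ 2 - (fst z - cos tau) ^ 2) / sq_dist z tau ^ 2 * h tau) (- PI) PI).
  exists (RInt (fun tau => (-2 * ((fst z - cos tau) * (snd z - sin tau))) / sq_dist z tau ^ 2 * h tau) (- PI) PI).
  intros al be a b.
  assert (Hz0 : (fst z + 0 * a, snd z + 0 * b) = z) by (destruct z; simpl; f_equal; ring).
  assert (Hz' := Hz). rewrite <- Hz0 in Hz'.
  set (k' := fun t tau : R => (0 * (fst z + t * a - cos tau) + 0 * (snd z + t * b - sin tau)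
     + -2 * (al * b + be * a) * ((fst z + t * a - cos tau) * (snd z + t * b - sin tau))
     + (al * a - be * b) * ((snd z + t * b - sin tau) ^ 2 - (fst z + t * a - cos tau) ^ 2))
       / sq_dist (fst z + t * a, snd z + t * b) tau ^ 2).
  replace (_ + _) with (RInt (fun tau => k' 0 tau * h tau) (- PI) PI).
  - apply (is_derive_RInt_weighted (fun t tau => (al * (fst z + t * a - cos tau) + be * (snd z + t * b - sin tau))
              / sq_dist (fst z + t * a, snd z + t * b) tau) k' h).
    + exact Hh.
    + generalize (open_disk_line z a b 0 Hz'). apply filter_imp. intros t Ht tau.
      assert (Hd := sq_dist_pos _ tau Ht). split.
      * unfold k', sq_dist in *. simpl fst in *. simpl snd in *.
        auto_derive; [apply Rgt_not_eq, Hd|]. field. apply Rgt_not_eq, Hd.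
      * apply continuous_ext with (2 := continuous_kernel 0 al be 0 0 _ 1 tau Ht).
        intros s. simpl fst. simpl snd. rewrite pow_1. f_equal. ring.
    + intros tau. apply continuity_2d_kernel; [exact Hz'|continuity_2d].
  - assert (E1 := ex_RInt_kernel 0 0 0 0 1 h z 2 Hz Hh).
    assert (E2 := ex_RInt_kernel 0 0 0 (-2) 0 h z 2 Hz Hh).
    rewrite <- !(RInt_scal (V := R_CompleteNormedModule)).
    rewrite <- (RInt_plus (V := R_CompleteNormedModule)).
    + apply RInt_ext. intros tau _. unfold k'. rewrite Hz0. rewrite !Rmult_0_l, !Rplus_0_r.
      unfold plus, scal. simpl. unfold mult. simpl. unfold Rdiv. ring.
    + apply @ex_RInt_scal. revert E1. apply ex_RInt_ext. intros tau _. ring_R.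
    + apply @ex_RInt_scal. revert E2. apply ex_RInt_ext. intros tau _. ring_R.
    + revert E2. apply ex_RInt_ext. intros tau _. ring_R.
    + revert E1. apply ex_RInt_ext. intros tau _. ring_R.
Qed.

Lemma is_derive_potential (h : R -> R) (z : C) (a b t : R) :
  open_disk (fst z + t * a, snd z + t * b) -> (forall tau, continuous h tau) ->
  is_derive (fun t => neumann_potential h (fst z + t * a, snd z + t * b)) t
    (- (1 / PI) * grad_log h a b (fst z + t * a, snd z + t * b)).
Proof.
  intros Hz Hh. unfold neumann_potential. apply is_derive_scal.
  apply (is_derive_RInt_weighted (fun t tau => ln (Cmod (((fst z + t * a)%R, (snd z + t * b)%R) - cis tau)%C))
    (fun t tau => (a * (fst z + t * a - cos tau) + b * (snd z + t * b - sin tau))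
              / sq_dist (fst z + t * a, snd z + t * b) tau)).
  - exact Hh.
  - generalize (open_disk_line z a b t Hz). apply filter_imp. intros s Hs tau.
    assert (Hd := sq_dist_pos _ tau Hs). split.
    + apply is_derive_ext with (fun t => ln (sqrt (sq_dist (fst z + t * a, snd z + t * b) tau))).
      { reflexivity. }
      unfold sq_dist in *. simpl fst in *. simpl snd in *.
      auto_derive.
      * split; [exact Hd|]. split; [apply sqrt_lt_R0, Hd|exact I].
      * set (X := fst z + s * a - cos tau) in *. set (Y := snd z + s * b - sin tau) in *.
        change (fst z + s * a + - cos tau) with X. change (snd z + s * b + - sin tau) with Y.
        replace (X * (X * 1) + Y * (Y * 1)) with (X ^ 2 + Y ^ 2) by ring.
        assert (HS := sqrt_lt_R0 _ Hd). assert (E := sqrt_sqrt _ (Rlt_le _ _ Hd)).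
        set (S := sqrt (X ^ 2 + Y ^ 2)) in *. rewrite <- E. field. lra.
    + apply continuous_ext with (fun tau => ln (sqrt (sq_dist (fst z + s * a, snd z + s * b) tau))).
      { reflexivity. }
      apply @ex_derive_continuous.
      unfold sq_dist in *. simpl fst in *. simpl snd in *. auto_derive.
      split; [exact Hd|]. split; [apply sqrt_lt_R0, Hd|exact I].
  - intros tau.
    apply continuity_2d_pt_ext with (fun t tau =>
      (a * (fst z + t * a - cos tau) + b * (snd z + t * b - sin tau))
      / sq_dist (fst z + t * a, snd z + t * b) tau ^ 1).
    { intros u v. now rewrite pow_1. }
    apply continuity_2d_kernel; [exact Hz|continuity_2d].
Qed.

Definition poisson (h : R -> R) (z : C) : R :=
  / (2 * PI) *
  RInt (fun tau => (1 - fst z ^ 2 - snd z ^ 2) / sq_dist z tau * h tau) (- PI) PI.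

(* The derivative of the Poisson kernel in the direction [(a, b)] is the
   derivative of [N] with respect to [tau]; integrating by parts moves it on [g]. *)
Lemma is_derive_poisson (g g' : R -> R) (z : C) (a b t : R) :
  open_disk (fst z + t * a, snd z + t * b) ->
  (forall tau, is_derive g tau (g' tau)) -> (forall tau, continuous g' tau) -> g PI = g (- PI) ->
  is_derive (fun t => poisson g (fst z + t * a, snd z + t * b)) t
    (1 / PI * grad_log g' (- b) a (fst z + t * a, snd z + t * b)).
Proof.
  intros Hz Hg Hg' Hper.
  assert (Cg : forall tau, continuous g tau).
  { intros tau. apply @ex_derive_continuous. eexists. apply Hg. }
  set (k' := fun t tau : R => let X := fst z + t * a - cos tau in let Y := snd z + t * b - sin tau in
     2 * (b * sin tau + a * cos tau) / sq_dist (fst z + t * a, snd z + t * b) tau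
     - 4 * (b * X - a * Y) * (X * sin tau - Y * cos tau)
           / sq_dist (fst z + t * a, snd z + t * b) tau ^ 2).
  (* Twice the derivative of [ln (Cmod (z - cis tau))], taken at the point of parameter [t], in the
     direction [(b, - a)], which is [(a, b)] turned clockwise by a quarter turn. *)
  set (N := fun tau => 2 * (b * (fst z + t * a - cos tau) - a * (snd z + t * b - sin tau))
                         / sq_dist (fst z + t * a, snd z + t * b) tau).
  assert (HN : forall tau, is_derive N tau (k' t tau)).
  { intros tau. assert (Hd := sq_dist_pos _ tau Hz). unfold N, k', sq_dist in *.
    simpl fst in *. simpl snd in *. auto_derive; [apply Rgt_not_eq, Hd|].
    field. apply Rgt_not_eq, Hd. }
  assert (Hk' : forall tau, continuous (k' t) tau).
  { intros tau. assert (Hd := sq_dist_pos _ tau Hz). apply @ex_derive_continuous.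
    unfold k', sq_dist in *. simpl fst in *. simpl snd in *. cbv zeta.
    auto_derive. repeat split; [apply Rgt_not_eq, Hd|].
    apply Rgt_not_eq, (Rmult_lt_0_compat _ _ Hd). rewrite Rmult_1_r. exact Hd. }
  assert (CN : forall tau, continuous N tau).
  { intros tau. apply @ex_derive_continuous. eexists. apply HN. }
  assert (Ekg : ex_RInt (fun tau => k' t tau * g tau) (- PI) PI).
  { apply @ex_RInt_continuous. intros tau _.
    apply (continuous_mult (k' t) g); [apply Hk'|apply Cg]. }
  assert (ENg : ex_RInt (fun tau => N tau * g' tau) (- PI) PI).
  { apply @ex_RInt_continuous. intros tau _.
    apply (continuous_mult N g'); [apply CN|apply Hg']. }
  assert (Hparts : RInt (fun tau => k' t tau * g tau) (- PI) PI
                   = - RInt (fun tau => N tau * g' tau) (- PI) PI).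
  { assert (HI : is_RInt (fun tau => k' t tau * g tau + N tau * g' tau) (- PI) PI
                   (minus (N PI * g PI) (N (- PI) * g (- PI)))).
    { apply (is_RInt_derive (fun tau => N tau * g tau)).
      - intros tau _. apply (is_derive_mult N g); [apply HN|apply Hg|].
        intros; apply Rmult_comm.
      - intros tau _. apply (continuous_plus (fun tau => k' t tau * g tau) (fun tau => N tau * g' tau)).
        + apply (continuous_mult (k' t) g); [apply Hk'|apply Cg].
        + apply (continuous_mult N g'); [apply CN|apply Hg']. }
    apply (is_RInt_unique (V := R_CompleteNormedModule)) in HI.
    rewrite (RInt_plus (V := R_CompleteNormedModule)) in HI by assumption.
    (* The boundary terms cancel since [N] and [g] take the same values at both ends of the
       period. *)
    assert (Hz0 : minus (N PI * g PI) (N (- PI) * g (- PI)) = 0).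
    { rewrite Hper. unfold N, sq_dist. rewrite cos_neg, sin_neg, sin_PI, Ropp_0.
      apply Rminus_diag_eq. reflexivity. }
    rewrite Hz0 in HI. unfold plus in HI. simpl in HI. lra. }
  replace (1 / PI * _) with (/ (2 * PI) * RInt (fun tau => k' t tau * g tau) (- PI) PI).
  - unfold poisson. apply is_derive_scal.
    apply (is_derive_RInt_weighted (fun t tau =>
      (1 - fst (fst z + t * a, snd z + t * b) ^ 2 - snd (fst z + t * a, snd z + t * b) ^ 2)
       / sq_dist (fst z + t * a, snd z + t * b) tau) k').
    + exact Cg.
    + generalize (open_disk_line z a b t Hz). apply filter_imp. intros s Hs tau.
      assert (Hd := sq_dist_pos _ tau Hs). split.
      * unfold k', sq_dist in *. simpl fst in *. simpl snd in *. cbv zeta.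
        (* Writing [1] as [cos tau ^ 2 + sin tau ^ 2] makes the equality with [k'] an identity of
           rational functions in [cos tau] and [sin tau]. *)
        apply is_derive_ext with (fun s => (cos tau ^ 2 + sin tau ^ 2 - (fst z + s * a) ^ 2
          - (snd z + s * b) ^ 2) / ((fst z + s * a - cos tau) ^ 2 + (snd z + s * b - sin tau) ^ 2)).
        { intros u. rewrite <- (sin2_cos2 tau). unfold Rsqr. f_equal. ring. }
        auto_derive; [apply Rgt_not_eq, Hd|]. field. apply Rgt_not_eq, Hd.
      * apply @ex_derive_continuous. unfold sq_dist in *. simpl fst in *. simpl snd in *.
        auto_derive. apply Rgt_not_eq, Hd.
    + intros tau. unfold k'. cbv zeta. apply continuity_2d_pt_minus.
      * apply continuity_2d_pt_ext with (fun t tau =>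
          2 * (b * sin tau + a * cos tau) / sq_dist (fst z + t * a, snd z + t * b) tau ^ 1).
        { intros u v. now rewrite pow_1. }
        apply continuity_2d_kernel; [exact Hz|continuity_2d].
      * apply continuity_2d_kernel; [exact Hz|continuity_2d].
  - rewrite Hparts. unfold grad_log. simpl fst. simpl snd.
    rewrite <- (RInt_opp (V := R_CompleteNormedModule)) by exact ENg.
    rewrite <- !(RInt_scal (V := R_CompleteNormedModule)).
    + apply RInt_ext. intros tau _. unfold scal, opp, N. simpl. unfold mult. simpl.
      pose proof PI_RGT_0. eq_R. assert (Hd := sq_dist_pos _ tau Hz). field.
      split; lra.
    + generalize (ex_RInt_kernel 0 (- b) a 0 0 g' _ 1 Hz Hg'). apply ex_RInt_ext.
      intros tau _. simpl fst. simpl snd. rewrite pow_1. ring_R.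
    + now apply @ex_RInt_opp.
Qed.

(** * Boundary values of the Poisson integral *)

Lemma closed_disk_scal (z : C) (s : R) : closed_disk z -> 0 <= s < 1 -> open_disk (s * fst z, s * snd z).
Proof.
  unfold closed_disk, open_disk. rewrite Cmod_le_1, Cmod_lt_1. simpl fst. simpl snd.
  intros Hz Hs. replace ((s * fst z) ^ 2 + (s * snd z) ^ 2)
    with (s ^ 2 * (fst z ^ 2 + snd z ^ 2)) by ring.
  pose proof (pow2_ge_0 (fst z)). pose proof (pow2_ge_0 (snd z)).
  set (q := fst z ^ 2 + snd z ^ 2) in *. assert (0 <= q) by (unfold q; lra).
  assert (0 <= s ^ 2 <= s) by nra. nra.
Qed.

Lemma open_disk_scal (z : C) (s : R) : open_disk z -> 0 <= s <= 1 -> open_disk (s * fst z, s * snd z).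
Proof.
  unfold closed_disk, open_disk. rewrite !Cmod_lt_1. simpl fst. simpl snd.
  intros Hz Hs. replace ((s * fst z) ^ 2 + (s * snd z) ^ 2)
    with (s ^ 2 * (fst z ^ 2 + snd z ^ 2)) by ring.
  pose proof (pow2_ge_0 (fst z)). pose proof (pow2_ge_0 (snd z)).
  set (q := fst z ^ 2 + snd z ^ 2) in *. assert (0 <= q) by (unfold q; lra).
  assert (0 <= s ^ 2 <= s) by nra. nra.
Qed.

Lemma poisson_kernel_nonneg (z : C) (tau : R) : open_disk z ->
  0 <= (1 - fst z ^ 2 - snd z ^ 2) / sq_dist z tau.
Proof.
  intros Hz. assert (Hd := sq_dist_pos z tau Hz).
  unfold open_disk in Hz. rewrite Cmod_lt_1 in Hz.
  apply Rmult_le_pos; [lra|]. apply Rlt_le, Rinv_0_lt_compat, Hd.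
Qed.

Lemma ex_RInt_poisson (h : R -> R) (z : C) : open_disk z -> (forall tau, continuous h tau) ->
  ex_RInt (fun tau => (1 - fst z ^ 2 - snd z ^ 2) / sq_dist z tau * h tau) (- PI) PI.
Proof.
  intros Hz Hh.
  generalize (ex_RInt_kernel (1 - fst z ^ 2 - snd z ^ 2) 0 0 0 0 h _ 1 Hz Hh).
  apply ex_RInt_ext. intros tau _. rewrite pow_1. ring_R.
Qed.

(** At the centre the kernel is constantly [1]. Along a ray the derivative is expressed by the
    derivative of the boundary data, here [0], so the value does not change. *)
Lemma poisson_1 (z : C) : open_disk z -> poisson (fun _ => 1) z = 1.
Proof.
  intros Hz. pose proof PI_RGT_0 as HPI.
  assert (H0 : poisson (fun _ => 1) (0 + 0 * fst z, 0 + 0 * snd z) = 1).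
  { unfold poisson. rewrite (RInt_ext _ (fun _ => 1)).
    - rewrite RInt_const. unfold scal. simpl. unfold mult. simpl. field. lra.
    - intros tau _. unfold sq_dist. simpl fst. simpl snd.
      replace ((0 + 0 * fst z - cos tau) ^ 2 + (0 + 0 * snd z - sin tau) ^ 2)
        with (Rsqr (sin tau) + Rsqr (cos tau)) by (unfold Rsqr; ring).
      rewrite sin2_cos2. eq_R. field. }
  assert (Hd : forall t, 0 <= t <= 1 ->
    is_derive (fun t => poisson (fun _ => 1) (0 + t * fst z, 0 + t * snd z)) t 0).
  { intros t Ht.
    assert (Ht' : open_disk (0 + t * fst z, 0 + t * snd z)).
    { rewrite !Rplus_0_l. now apply open_disk_scal. }
    assert (H := is_derive_poisson (fun _ => 1) (fun _ => 0) (0, 0) (fst z) (snd z) t Ht'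
                   (fun tau => is_derive_const _ _) (fun tau => continuous_const _ _) eq_refl).
    assert (E : forall a b w, grad_log (fun _ => 0) a b w = 0).
    { intros a b w. unfold grad_log. rewrite (RInt_ext _ (fun _ => 0)).
      - rewrite RInt_const. unfold scal. simpl. unfold mult. simpl. ring.
      - intros tau _. apply Rmult_0_r. }
    rewrite E, Rmult_0_r in H. exact H. }
  destruct (MVT_gen (fun t => poisson (fun _ => 1) (0 + t * fst z, 0 + t * snd z)) 0 1 (fun _ => 0))
    as [c [_ Hc]].
  - intros t Ht. rewrite Rmin_left, Rmax_right in Ht by lra. apply Hd. lra.
  - intros t Ht. rewrite Rmin_left, Rmax_right in Ht by lra.
    apply continuity_pt_filterlim. apply @ex_derive_continuous. eexists. now apply Hd.
  - cbv beta in Hc. rewrite H0 in Hc.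
    replace (0 + 1 * fst z, 0 + 1 * snd z) with z in Hc by (destruct z; simpl; f_equal; ring).
    lra.
Qed.

Lemma is_RInt_poisson_kernel (z : C) (a k : R) : open_disk z ->
  is_RInt (fun tau => a * ((1 - fst z ^ 2 - snd z ^ 2) / sq_dist z tau) + k) (- PI) PI
    (2 * PI * (a + k)).
Proof.
  intros Hz. pose proof PI_RGT_0 as HPI.
  assert (E : is_RInt (fun tau => (1 - fst z ^ 2 - snd z ^ 2) / sq_dist z tau * 1) (- PI) PI (2 * PI)).
  { assert (H1 := poisson_1 z Hz). unfold poisson in H1.
    replace (2 * PI) with (RInt (fun tau => (1 - fst z ^ 2 - snd z ^ 2) / sq_dist z tau * 1) (- PI) PI).
    - apply (RInt_correct (V := R_CompleteNormedModule)).
      apply (ex_RInt_poisson (fun _ => 1)); [exact Hz|]. intros; apply continuous_const.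
    - apply Rmult_eq_reg_l with (/ (2 * PI)).
      + transitivity 1; [exact H1|]. field. lra.
      + apply Rinv_neq_0_compat. lra. }
  replace (2 * PI * (a + k)) with (plus (scal a (2 * PI)) (scal (PI - - PI) k)).
  2: { unfold plus, scal. simpl. unfold mult. simpl. ring. }
  apply @is_RInt_plus; [|apply @is_RInt_const].
  apply is_RInt_ext with (fun tau => scal a ((1 - fst z ^ 2 - snd z ^ 2) / sq_dist z tau * 1)).
  { intros tau _. unfold scal. simpl. unfold mult. simpl. ring_R. }
  now apply @is_RInt_scal.
Qed.

(** The bounds mix two kinds of error: a multiple of the kernel [P], suited to angles where [h] is
    close to its limit, and a constant [k], suited to angles where [P] itself is small. With total
    mass normalized to 1, both pass to the integral. *)
Lemma poisson_bounds (h : R -> R) (z : C) (a b k : R) :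
  open_disk z -> (forall tau, continuous h tau) ->
  (forall tau, - PI <= tau <= PI -> let P := (1 - fst z ^ 2 - snd z ^ 2) / sq_dist z tau in
     a * P - k <= P * h tau <= b * P + k) ->
  a - k <= poisson h z <= b + k.
Proof.
  intros Hz Hh Hb. pose proof PI_RGT_0 as HPI.
  assert (E := RInt_correct (V := R_CompleteNormedModule) _ _ _ (ex_RInt_poisson h z Hz Hh)).
  unfold poisson. set (I := RInt _ _ _ : R) in *.
  assert (Hpi : - PI <= PI) by lra.
  assert (H1 := is_RInt_le _ _ _ _ _ _ Hpi (is_RInt_poisson_kernel z a (- k) Hz) E).
  assert (H2 := is_RInt_le _ _ _ _ _ _ Hpi E (is_RInt_poisson_kernel z b k Hz)).
  assert (L1 : 2 * PI * (a + - k) <= I).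
  { apply H1. intros tau Ht. apply (Hb tau). lra. }
  assert (L2 : I <= 2 * PI * (b + k)).
  { apply H2. intros tau Ht. apply (Hb tau). lra. }
  set (J := / (2 * PI) * I).
  assert (HI : (I : R) = 2 * PI * J) by (unfold J; eq_R; field; lra).
  rewrite HI in L1, L2. split.
  - apply Rmult_le_reg_l with (2 * PI); lra.
  - apply Rmult_le_reg_l with (2 * PI); lra.
Qed.

Lemma poisson_abs_le (h : R -> R) (z : C) (M : R) :
  open_disk z -> (forall tau, continuous h tau) ->
  (forall tau, - PI <= tau <= PI -> Rabs (h tau) <= M) -> Rabs (poisson h z) <= M.
Proof.
  intros Hz Hh Hb.
  destruct (poisson_bounds h z (- M) M 0 Hz Hh) as [H1 H2].
  - intros tau Ht P. assert (HP := poisson_kernel_nonneg z tau Hz). fold P in HP.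
    specialize (Hb tau Ht). apply Rabs_le_between in Hb. nra.
  - apply Rabs_le. lra.
Qed.

(** * Periodic functions and distance on the circle *)

Lemma periodic_Z (h : R -> R) : (forall t, h (t + 2 * PI) = h t) ->
  forall (k : Z) t, h (t + 2 * PI * IZR k) = h t.
Proof.
  intros Hp.
  assert (Hn : forall n t, h (t + 2 * PI * INR n) = h t).
  { induction n; intros t.
    - simpl. f_equal. ring.
    - rewrite S_INR. replace (t + 2 * PI * (INR n + 1)) with ((t + 2 * PI * INR n) + 2 * PI) by ring.
      now rewrite Hp. }
  intros k t. destruct (Z.le_gt_cases 0 k) as [Hk|Hk].
  - rewrite <- (Z2Nat.id k Hk), <- INR_IZR_INZ. apply Hn.
  - rewrite <- (Hn (Z.to_nat (- k))). f_equal. rewrite INR_IZR_INZ, Z2Nat.id by lia.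
    rewrite opp_IZR. ring.
Qed.

Lemma periodic_shift (t0 t : R) : exists k : Z, - PI <= t + 2 * PI * IZR k - t0 <= PI.
Proof.
  pose proof PI_RGT_0 as HPI.
  (* Subtracting [/ 2] turns [up] into rounding to a nearest integer. *)
  exists (- (up ((t - t0) / (2 * PI) - / 2)))%Z.
  destruct (archimed ((t - t0) / (2 * PI) - / 2)) as [H1 H2].
  set (m := IZR (up ((t - t0) / (2 * PI) - / 2))) in *. rewrite opp_IZR. fold m.
  assert (E : t - t0 = 2 * PI * ((t - t0) / (2 * PI))) by (field; lra).
  set (q := (t - t0) / (2 * PI)) in *.
  replace (t + 2 * PI * - m - t0) with (2 * PI * (q - m)) by lra.
  split; nra.
Qed.

(** For the representative [r] of [t] within [PI] of [t0], the chord has length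
    [2 * sin (Rabs (r - t0) / 2)]. The sine increases on the first quadrant, so a short chord forces
    a short arc; [d <= PI] keeps the half angles there. *)
Lemma periodic_continuous_chord (h : R -> R) (t0 eps : R) :
  (forall t, h (t + 2 * PI) = h t) -> continuous h t0 -> 0 < eps ->
  exists d, 0 < d /\ forall t, (cos t - cos t0) ^ 2 + (sin t - sin t0) ^ 2 < d ^ 2 ->
    Rabs (h t - h t0) < eps.
Proof.
  intros Hp Hc He. pose proof PI_RGT_0 as HPI.
  destruct (Hc (ball (h t0) (mkposreal eps He)) (locally_ball _ _)) as [d1 Hd1].
  set (d := Rmin d1 PI). pose proof (cond_pos d1) as Hd1p.
  assert (Hd : 0 < d <= PI /\ d <= d1).
  { unfold d. pose proof (Rmin_l d1 PI). pose proof (Rmin_r d1 PI).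
    assert (0 < Rmin d1 PI) by now apply Rmin_pos. lra. }
  assert (Hs : 0 < sin (d / 2)) by (apply sin_gt_0; lra).
  exists (2 * sin (d / 2)). split; [lra|]. intros t Ht.
  destruct (periodic_shift t0 t) as [k Hk].
  rewrite <- (periodic_Z h Hp k t).
  set (r := t + 2 * PI * IZR k) in *.
  assert (Ecos : cos r = cos t).
  { apply (periodic_Z cos). intros s. rewrite cos_plus, cos_2PI, sin_2PI. ring. }
  assert (Esin : sin r = sin t).
  { apply (periodic_Z sin). intros s. rewrite sin_plus, cos_2PI, sin_2PI. ring. }
  rewrite <- Ecos, <- Esin in Ht.
  assert (Hchord : (cos r - cos t0) ^ 2 + (sin r - sin t0) ^ 2 = (2 * sin ((r - t0) / 2)) ^ 2).
  { assert (H1 := sin2_cos2 r). assert (H2 := sin2_cos2 t0). unfold Rsqr in *.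
    assert (H3 := cos_minus r t0).
    replace (cos (r - t0)) with (cos (2 * ((r - t0) / 2))) in H3 by (f_equal; field).
    rewrite cos_2a_sin in H3. nra. }
  rewrite Hchord in Ht.
  apply Hd1. change (Rabs (r - t0) < d1).
  apply Rlt_le_trans with d; [|lra].
  apply Rnot_le_lt. intros Hle.
  assert (Hss : sin (d / 2) <= sin (Rabs (r - t0) / 2)).
  { assert (Rabs (r - t0) <= PI) by (apply Rabs_le; lra).
    apply sin_incr_1; lra. }
  assert (Heq : (2 * sin (Rabs (r - t0) / 2)) ^ 2 = (2 * sin ((r - t0) / 2)) ^ 2).
  { unfold Rabs. destruct (Rcase_abs (r - t0)); [|reflexivity].
    replace (- (r - t0) / 2) with (- ((r - t0) / 2)) by field. rewrite sin_neg. ring. }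
  nra.
Qed.

Lemma bounded_on_period (h : R -> R) : (forall t, continuous h t) ->
  exists M, 0 <= M /\ forall t, - PI <= t <= PI -> Rabs (h t) <= M.
Proof.
  intros Hh. pose proof PI_RGT_0 as HPI.
  destruct (continuity_ab_maj (fun t => Rabs (h t)) (- PI) PI) as [m [H1 H2]].
  - lra.
  - intros t _. apply continuity_pt_filterlim.
    apply (continuous_comp h Rabs); [apply Hh|apply continuous_Rabs].
  - exists (Rabs (h m)). split; [apply Rabs_pos|exact H1].
Qed.

(** The kernel is a nonnegative weight of mean 1 that concentrates near [cis t0]. The approach is
    from any direction inside the disk, as continuity of the glued function in the Dirichlet problem
    requires. *)
Lemma poisson_boundary (h : R -> R) (t0 eps : R) :
  (forall t, h (t + 2 * PI) = h t) -> (forall t, continuous h t) -> 0 < eps ->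
  exists d, 0 < d /\ forall z, open_disk z -> Cmod (z - cis t0)%C < d ->
    Rabs (poisson h z - h t0) < eps.
Proof.
  intros Hp Hh He.
  destruct (bounded_on_period h Hh) as [M [HM0 HM]].
  assert (He2 : 0 < eps / 2) by lra.
  destruct (periodic_continuous_chord h t0 _ Hp (Hh t0) He2) as [d [Hd Hchord]].
  set (K := M + Rabs (h t0)).
  assert (HK : 0 <= K) by (unfold K; pose proof (Rabs_pos (h t0)); lra).
  (* Away from [cis t0] the kernel is at most [(1 - |z|^2) / (d / 2)^2]. *)
  set (d2 := Rmin (d / 2) (eps * (d / 2) ^ 2 / (8 * (K + 1)))).
  assert (Hd2 : 0 < d2).
  { unfold d2. apply Rmin_pos; [lra|]. apply Rdiv_lt_0_compat; [|lra].
    apply Rmult_lt_0_compat; [exact He|]. apply pow_lt. lra. }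
  exists d2. split; [exact Hd2|]. intros z Hz Hzd.
  assert (E1 : Cmod (cis t0) = 1).
  { apply Cmod_eq_1. simpl fst. simpl snd. rewrite <- (sin2_cos2 t0). unfold Rsqr. ring. }
  assert (Hz1 : 1 - Cmod z < d2).
  { pose proof (Cmod_le_plus z (cis t0)) as H. rewrite E1 in H.
    replace (cis t0 - z)%C with (- (z - cis t0))%C in H by ring. rewrite Cmod_opp in H. lra. }
  assert (Hz2 : 1 - fst z ^ 2 - snd z ^ 2 <= 2 * d2).
  { assert (H : Cmod z ^ 2 = fst z ^ 2 + snd z ^ 2) by apply Cmod2_alt.
    unfold open_disk in Hz. pose proof (Cmod_ge_0 z). nra. }
  assert (Hz3 : 0 < 1 - fst z ^ 2 - snd z ^ 2).
  { unfold open_disk in Hz. rewrite Cmod_lt_1 in Hz. lra. }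
  assert (Hd2a : d2 <= d / 2) by apply Rmin_l.
  assert (Hd2b : d2 * (8 * (K + 1)) <= eps * (d / 2) ^ 2).
  { apply Rle_div_r; [lra|apply Rmin_r]. }
  (* On the arc near [t0], [h] is within [eps / 2] of [h t0]; elsewhere the error is at most
     [P * K <= eps / 4]. Their sum [3 * eps / 4] leaves room for the strict inequality. *)
  destruct (poisson_bounds h z (h t0 - eps / 2) (h t0 + eps / 2) (eps / 4) Hz Hh) as [H1 H2].
  2: { apply Rabs_def1; lra. }
  intros tau Ht P.
  assert (HP := poisson_kernel_nonneg z tau Hz). fold P in HP.
  destruct (Rlt_le_dec ((cos tau - cos t0) ^ 2 + (sin tau - sin t0) ^ 2) (d ^ 2)) as [Hc|Hc].
  - specialize (Hchord tau Hc). apply Rabs_def2 in Hchord. nra.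
  - assert (Hsq : (d / 2) ^ 2 <= sq_dist z tau).
    { assert (Hc1 : d <= Cmod (cis tau - cis t0)%C).
      { change (d <= sqrt ((cos tau - cos t0) ^ 2 + (sin tau - sin t0) ^ 2)).
        rewrite <- (sqrt_pow2 d) by lra. now apply sqrt_le_1_alt. }
      assert (Hc2 : d / 2 <= Cmod (z - cis tau)%C).
      { pose proof (Cmod_triangle (z - cis t0) (- (z - cis tau))) as H.
        replace (z - cis t0 + - (z - cis tau))%C with (cis tau - cis t0)%C in H by ring.
        rewrite Cmod_opp in H. lra. }
      rewrite Cmod_sub_cis in Hc2.
      rewrite <- (pow2_sqrt (sq_dist z tau)) by (apply Rlt_le, sq_dist_pos, Hz).
      apply pow_incr. lra. }
    assert (HPK : P * K <= eps / 4).
    { assert (Hs := sq_dist_pos z tau Hz).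
      assert (HPs : P * sq_dist z tau = 1 - fst z ^ 2 - snd z ^ 2) by (unfold P; field; lra).
      assert (0 < (d / 2) ^ 2) by (apply pow_lt; lra).
      apply Rmult_le_reg_r with ((d / 2) ^ 2); [assumption|].
      apply Rle_trans with (P * sq_dist z tau * K); [|rewrite HPs; nra].
      rewrite Rmult_assoc, (Rmult_comm K), <- Rmult_assoc.
      apply Rmult_le_compat_r; [exact HK|]. apply Rmult_le_compat_l; assumption. }
    assert (Hdiff : Rabs (h tau - h t0) <= K).
    { unfold K. specialize (HM tau Ht). pose proof (Rabs_triang (h tau) (- h t0)) as H.
      rewrite Rabs_Ropp in H. unfold Rminus. lra. }
    apply Rabs_le_between in Hdiff. nra.
Qed.

(** * Boundary values of the potential *)

(** The mean value theorem on the segment from [z] to [z']: a bound on directional derivatives that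
    may blow up at the circle still gives continuity inside. *)
Lemma continuous_of_line_derivatives (f : C -> R) (G : R -> R -> C -> R) (K : R) :
  0 <= K ->
  (forall z a b t, open_disk (fst z + t * a, snd z + t * b) ->
    is_derive (fun t => f (fst z + t * a, snd z + t * b)) t
      (G a b (fst z + t * a, snd z + t * b))) ->
  (forall z a b, open_disk z -> Rabs (G a b z) * (1 - Cmod z) <= K * (Rabs a + Rabs b)) ->
  forall z, open_disk z -> forall eps, 0 < eps -> exists d, 0 < d /\
    forall z', Rabs (fst z' - fst z) < d -> Rabs (snd z' - snd z) < d ->
      Rabs (f z' - f z) < eps.
Proof.
  intros HK Hf HG z Hz eps He. unfold open_disk in Hz.
  set (m := (1 - Cmod z) / 2). assert (Hm : 0 < m) by (unfold m; lra).
  (* The first bound keeps the segment at distance [m] from the circle. By the second, the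
     derivative along the segment, at most [K * (2 * d) / m], is below [eps]. *)
  exists (Rmin (m / 2) (eps * m / (2 * K + 1))).
  assert (Hq : 0 < eps * m / (2 * K + 1)) by (apply Rdiv_lt_0_compat; nra).
  split; [apply Rmin_pos; lra|].
  intros z' H1 H2.
  pose proof (Rmin_l (m / 2) (eps * m / (2 * K + 1))) as D1.
  pose proof (Rmin_r (m / 2) (eps * m / (2 * K + 1))) as D2.
  apply Rle_div_r in D2; [|lra].
  set (d := Rmin _ _) in *.
  set (a := fst z' - fst z) in *. set (b := snd z' - snd z) in *.
  pose proof (Rabs_pos a) as Ha. pose proof (Rabs_pos b) as Hb.
  assert (Hin : forall t, 0 <= t <= 1 -> Cmod (fst z + t * a, snd z + t * b) < 1 - m).
  { intros t Ht. set (p := (fst z + t * a, snd z + t * b) : C).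
    assert (Hp : Cmod (p - z)%C < 2 * (m / 2)).
    { apply Cmod_box; unfold p; simpl.
      - replace (fst z + t * a - fst z) with (t * a) by ring.
        rewrite Rabs_mult, Rabs_pos_eq by lra. nra.
      - replace (snd z + t * b - snd z) with (t * b) by ring.
        rewrite Rabs_mult, Rabs_pos_eq by lra. nra. }
    pose proof (Cmod_le_plus z p). unfold m in *. lra. }
  assert (Hin' : forall t, 0 <= t <= 1 -> open_disk (fst z + t * a, snd z + t * b)).
  { intros t Ht. unfold open_disk. specialize (Hin t Ht). lra. }
  destruct (MVT_gen (fun t => f (fst z + t * a, snd z + t * b)) 0 1
              (fun t => G a b (fst z + t * a, snd z + t * b))) as [c [Hc Hc']].
  - intros t Ht. rewrite Rmin_left, Rmax_right in Ht by lra. apply Hf, Hin'. lra.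
  - intros t Ht. rewrite Rmin_left, Rmax_right in Ht by lra.
    apply continuity_pt_filterlim. apply @ex_derive_continuous. eexists. now apply Hf, Hin'.
  - rewrite Rmin_left, Rmax_right in Hc by lra.
    replace (fst z + 1 * a, snd z + 1 * b) with z' in Hc'
      by (unfold a, b; destruct z'; simpl; f_equal; ring).
    replace (fst z + 0 * a, snd z + 0 * b) with z in Hc'
      by (destruct z; simpl; f_equal; ring).
    rewrite Hc', Rminus_0_r, Rmult_1_r.
    specialize (HG _ a b (Hin' c Hc)). specialize (Hin c Hc).
    set (g := Rabs (G a b (fst z + c * a, snd z + c * b))) in *.
    assert (0 <= g) by apply Rabs_pos.
    apply Rmult_lt_reg_r with m; [exact Hm|].
    apply Rle_lt_trans with (K * (2 * d)); [|nra].
    apply Rle_trans with (1 := Rmult_le_compat_l g m (1 - Cmod (fst z + c * a, snd z + c * b)) ltac:(assumption) ltac:(lra)).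
    apply Rle_trans with (1 := HG). apply Rmult_le_compat_l; lra.
Qed.

(** The gradient of the logarithm has modulus [1 / Cmod (z - cis tau)], at most [1 / (1 - Cmod z)],
    and the period has length [2 * PI]. *)
Lemma grad_log_bound (h : R -> R) (M : R) (z : C) (a b : R) :
  (forall tau, continuous h tau) -> 0 <= M ->
  (forall tau, - PI <= tau <= PI -> Rabs (h tau) <= M) -> open_disk z ->
  Rabs (grad_log h a b z) * (1 - Cmod z) <= 2 * PI * M * (Rabs a + Rabs b).
Proof.
  intros Hh HM0 HM Hz. pose proof PI_RGT_0 as HPI.
  assert (Hm : 0 < 1 - Cmod z) by (unfold open_disk in Hz; lra).
  pose proof (Rabs_pos a) as Ha. pose proof (Rabs_pos b) as Hb.
  apply Rle_div_r; [exact Hm|].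
  assert (E : ex_RInt (fun tau => (a * (fst z - cos tau) + b * (snd z - sin tau))
                         / sq_dist z tau * h tau) (- PI) PI).
  { generalize (ex_RInt_kernel 0 a b 0 0 h z 1 Hz Hh). apply ex_RInt_ext.
    intros tau _. rewrite pow_1. ring_R. }
  replace (2 * PI * M * (Rabs a + Rabs b) / (1 - Cmod z))
    with ((PI - - PI) * (M * (Rabs a + Rabs b) / (1 - Cmod z))) by (field; lra).
  apply (norm_RInt_le_const (V := R_NormedModule)) with (3 := RInt_correct (V := R_CompleteNormedModule) _ _ _ E); [lra|].
  intros tau Ht. change (norm ?p) with (Rabs p).
  assert (Hd := sq_dist_pos z tau Hz).
  assert (Hge : 1 - Cmod z <= sqrt (sq_dist z tau)).
  { rewrite <- (sqrt_pow2 (1 - Cmod z)) by lra. apply sqrt_le_1_alt, sq_dist_ge, Hz. }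
  assert (Hs : 0 < sqrt (sq_dist z tau)) by now apply sqrt_lt_R0.
  assert (Hss := sqrt_sqrt _ (Rlt_le _ _ Hd)).
  assert (Hmax := Rmax_Cmod (z - cis tau)%C). rewrite Cmod_sub_cis in Hmax.
  set (s := sqrt (sq_dist z tau)) in *.
  change (Rmax (Rabs (fst z - cos tau)) (Rabs (snd z - sin tau)) <= s) in Hmax.
  set (X := fst z - cos tau) in *. set (Y := snd z - sin tau) in *.
  pose proof (Rmax_l (Rabs X) (Rabs Y)). pose proof (Rmax_r (Rabs X) (Rabs Y)).
  rewrite Rabs_mult, Rabs_div, (Rabs_pos_eq (sq_dist z tau)) by lra.
  rewrite <- Hss.
  assert (H1 : Rabs (a * X + b * Y) <= (Rabs a + Rabs b) * s).
  { apply Rle_trans with (1 := Rabs_triang _ _). rewrite !Rabs_mult. nra. }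
  assert (H2 : Rabs (a * X + b * Y) / (s * s) <= (Rabs a + Rabs b) / (1 - Cmod z)).
  { apply Rle_trans with ((Rabs a + Rabs b) / s).
    - replace ((Rabs a + Rabs b) / s) with ((Rabs a + Rabs b) * s / (s * s)) by (field; lra).
      apply Rmult_le_compat_r; [|exact H1]. apply Rlt_le, Rinv_0_lt_compat. nra.
    - apply Rmult_le_compat_l; [lra|]. now apply Rinv_le_contravar. }
  replace (M * (Rabs a + Rabs b) / (1 - Cmod z)) with ((Rabs a + Rabs b) / (1 - Cmod z) * M) by (field; lra).
  apply Rmult_le_compat.
  - apply Rmult_le_pos; [apply Rabs_pos|]. apply Rlt_le, Rinv_0_lt_compat. nra.
  - apply Rabs_pos.
  - exact H2.
  - now apply HM.
Qed.

(** For [z = (s * x, s * y)], twice the scalar product of [z] with [z - cis tau] is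
    [sq_dist z tau - (1 - Cmod z ^ 2)]. The radial kernel is thus half of a constant minus the
    Poisson kernel, and the constant integrates to [0] against [h]. *)
Lemma is_derive_potential_radial (h : R -> R) (x y s : R) :
  (forall tau, continuous h tau) -> RInt h (- PI) PI = 0 ->
  s <> 0 -> open_disk (s * x, s * y) ->
  is_derive (fun s => neumann_potential h (s * x, s * y)) s (poisson h (s * x, s * y) / s).
Proof.
  intros Hh H0 Hs Hz. pose proof PI_RGT_0 as HPI.
  assert (Hz0 : forall s, (fst (0, 0) + s * x, snd (0, 0) + s * y) = (s * x, s * y)).
  { intros t. simpl. f_equal; ring. }
  assert (Hz' : open_disk (fst (0, 0) + s * x, snd (0, 0) + s * y)) by now rewrite Hz0.
  apply is_derive_ext with (fun s => neumann_potential h (fst (0, 0) + s * x, snd (0, 0) + s * y)).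
  { intros t. now rewrite Hz0. }
  replace (poisson h (s * x, s * y) / s)
    with (- (1 / PI) * grad_log h x y (fst (0, 0) + s * x, snd (0, 0) + s * y)).
  { now apply is_derive_potential. }
  rewrite Hz0. unfold grad_log, poisson. set (z := (s * x, s * y) : C) in *.
  assert (E : RInt (fun tau => (x * (fst z - cos tau) + y * (snd z - sin tau)) / sq_dist z tau * h tau)
       (- PI) PI = - / (2 * s) * RInt (fun tau =>
         (1 - fst z ^ 2 - snd z ^ 2) / sq_dist z tau * h tau) (- PI) PI).
  { transitivity (plus (scal (/ (2 * s)) (RInt h (- PI) PI)) (scal (- / (2 * s)) (RInt (fun tau =>
         (1 - fst z ^ 2 - snd z ^ 2) / sq_dist z tau * h tau) (- PI) PI))).
    2: { rewrite H0. unfold plus, scal. simpl. unfold mult. simpl. ring. }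
    assert (EP := ex_RInt_poisson h z Hz Hh).
    assert (Eh : ex_RInt h (- PI) PI).
    { apply @ex_RInt_continuous. intros; apply Hh. }
    rewrite <- !(RInt_scal (V := R_CompleteNormedModule)) by assumption.
    rewrite <- (RInt_plus (V := R_CompleteNormedModule)) by now apply @ex_RInt_scal.
    apply RInt_ext. intros tau _. unfold plus, scal. simpl. unfold mult. simpl.
    eq_R.
    assert (Hd := sq_dist_pos z tau Hz).
    assert (Hid : 2 * s * (x * (s * x - cos tau) + y * (s * y - sin tau))
              = sq_dist z tau - (1 - (s * x) ^ 2 - (s * y) ^ 2)).
    { unfold sq_dist, z. simpl fst. simpl snd.
      assert (H1 := sin2_cos2 tau). unfold Rsqr in H1. nra. }
    apply Rmult_eq_reg_l with (2 * s * sq_dist z tau); [|nra].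
    transitivity (2 * s * (x * (s * x - cos tau) + y * (s * y - sin tau)) * h tau).
    - field. lra.
    - rewrite Hid. field. split; lra. }
  rewrite E. field. lra.
Qed.

(** The extension of [f] to the closed disk. The radii start at [1 / 2], so they all lie where the
    division by the radius in the radial derivative is harmless. *)
Definition radial_limit (f : C -> R) (z : C) : R :=
  real (Lim_seq (fun n => f ((1 - / (INR n + 2)) * fst z, (1 - / (INR n + 2)) * snd z))).

(** A Lipschitz bound along the ray makes the values Cauchy, so the limit is a true one, and the
    bound survives in the limit. *)
Lemma radial_limit_le (f : C -> R) (M : R) (z : C) : 0 <= M ->
  (forall s s', 1 / 2 <= s -> s < s' -> s' < 1 ->
     Rabs (f (s' * fst z, s' * snd z) - f (s * fst z, s * snd z)) <= M * (s' - s)) ->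
  forall s, 1 / 2 <= s < 1 ->
    Rabs (radial_limit f z - f (s * fst z, s * snd z)) <= M * (1 - s).
Proof.
  intros HM Hf.
  set (r := fun n => 1 - / (INR n + 2)).
  set (F := fun s => f (s * fst z, s * snd z)).
  assert (Hr : forall n, 1 / 2 <= r n < 1).
  { intros n. unfold r. pose proof (pos_INR n).
    assert (0 < / (INR n + 2)) by (apply Rinv_0_lt_compat; lra).
    assert (/ (INR n + 2) <= / 2) by (apply Rinv_le_contravar; lra). lra. }
  assert (Hf' : forall s s', 1 / 2 <= s < 1 -> 1 / 2 <= s' < 1 ->
             Rabs (F s' - F s) <= M * Rabs (s' - s)).
  { intros s s' Hs Hs'. destruct (Rtotal_order s s') as [H|[H|H]].
    - rewrite (Rabs_pos_eq (s' - s)) by lra. apply Hf; lra.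
    - subst. rewrite !Rminus_diag, Rabs_R0. lra.
    - rewrite (Rabs_minus_sym s' s), Rabs_minus_sym, (Rabs_pos_eq (s - s')) by lra.
      apply Hf; lra. }
  assert (Hlarge : forall eps, 0 < eps -> exists N, forall n, (N <= n)%nat -> 1 - eps < r n).
  { intros eps He. destruct (archimed (/ eps)) as [HN _].
    exists (Z.to_nat (up (/ eps))). intros n Hn.
    assert (Hup : (0 <= up (/ eps))%Z).
    { apply le_IZR. apply Rinv_0_lt_compat in He. lra. }
    assert (Hn' : / eps < INR n).
    { apply Rlt_le_trans with (1 := HN). apply le_INR in Hn.
      rewrite INR_IZR_INZ, Z2Nat.id in Hn by exact Hup. exact Hn. }
    unfold r. assert (/ (INR n + 2) < eps); [|lra].
    rewrite <- (Rinv_inv eps). apply Rinv_lt_contravar.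
    - apply Rmult_lt_0_compat; [now apply Rinv_0_lt_compat|]. pose proof (pos_INR n). lra.
    - lra. }
  assert (Hlim : ex_finite_lim_seq (fun n => F (r n))).
  { apply ex_lim_seq_cauchy_corr. intros eps.
    assert (He : 0 < eps / (M + 1)) by (apply Rdiv_lt_0_compat; [apply cond_pos|lra]).
    destruct (Hlarge _ He) as [N HN]. exists N. intros n m Hn Hm.
    apply Rle_lt_trans with (1 := Hf' _ _ (Hr m) (Hr n)).
    assert (Rabs (r n - r m) < eps / (M + 1)).
    { specialize (HN n Hn) as HNn. specialize (HN m Hm). pose proof (Hr n). pose proof (Hr m).
      apply Rabs_def1; lra. }
    assert (eps = (M + 1) * (eps / (M + 1)) :> R) by (field; lra).
    pose proof (Rabs_pos (r n - r m)). nra. }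
  apply Lim_seq_correct' in Hlim.
  change (Lim_seq (fun n => F (r n))) with
    (Lim_seq (fun n => f ((1 - / (INR n + 2)) * fst z, (1 - / (INR n + 2)) * snd z))) in Hlim.
  fold (radial_limit f z) in Hlim.
  intros s Hs. apply Rnot_lt_le. intros Hlt.
  set (e := Rabs (radial_limit f z - f (s * fst z, s * snd z)) - M * (1 - s)).
  assert (He : 0 < e) by (unfold e; lra).
  destruct (proj2 (is_lim_seq_spec (fun n => F (r n)) (radial_limit f z)) Hlim (mkposreal e He)) as [N1 HN1]. simpl in HN1.
  destruct (Hlarge (1 - s) ltac:(lra)) as [N2 HN2].
  specialize (HN1 (max N1 N2) ltac:(lia)). specialize (HN2 (max N1 N2) ltac:(lia)).
  set (n := max N1 N2) in *.
  assert (H1 := Hf' s (r n) Hs (Hr n)). pose proof (Hr n).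
  rewrite (Rabs_pos_eq (r n - s)) in H1 by lra.
  assert (M * (r n - s) <= M * (1 - s)) by (apply Rmult_le_compat_l; lra).
  change (f (s * fst z, s * snd z)) with (F s) in *.
  pose proof (Rabs_triang (radial_limit f z - F (r n)) (F (r n) - F s)) as HT.
  replace (radial_limit f z - F (r n) + (F (r n) - F s)) with (radial_limit f z - F s) in HT by ring.
  rewrite (Rabs_minus_sym (radial_limit f z) (F (r n))) in HT. unfold e in *. lra.
Qed.

(** Used with [c = 0] for the Lipschitz bound along rays and with [c = h t] for the normal
    derivative. It stays strictly inside the disk, where the derivative is known. *)
Lemma potential_increment (h : R -> R) (z : C) (s s' c e : R) :
  (forall tau, continuous h tau) -> RInt h (- PI) PI = 0 -> closed_disk z ->
  0 < s -> s < s' -> s' < 1 ->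
  (forall xi, s <= xi <= s' -> Rabs (poisson h (xi * fst z, xi * snd z) / xi - c) <= e) ->
  Rabs (neumann_potential h (s' * fst z, s' * snd z) - neumann_potential h (s * fst z, s * snd z)
        - c * (s' - s)) <= e * (s' - s).
Proof.
  intros Hh H0 Hz Hs Hss Hs' He.
  assert (Hd : forall xi, s <= xi <= s' ->
    is_derive (fun s => neumann_potential h (s * fst z, s * snd z)) xi
      (poisson h (xi * fst z, xi * snd z) / xi)).
  { intros xi Hxi. apply is_derive_potential_radial; [exact Hh|exact H0|lra|].
    apply closed_disk_scal; [exact Hz|lra]. }
  destruct (MVT_gen (fun s => neumann_potential h (s * fst z, s * snd z)) s s'
     (fun xi => poisson h (xi * fst z, xi * snd z) / xi)) as [xi [Hxi E]].
  - intros xi Hxi. rewrite Rmin_left, Rmax_right in Hxi by lra. apply Hd. lra.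
  - intros xi Hxi. rewrite Rmin_left, Rmax_right in Hxi by lra.
    apply continuity_pt_filterlim. apply @ex_derive_continuous. eexists. now apply Hd.
  - rewrite Rmin_left, Rmax_right in Hxi by lra. rewrite E, <- Rmult_minus_distr_r, Rabs_mult.
    rewrite (Rabs_pos_eq (s' - s)) by lra. apply Rmult_le_compat_r; [lra|]. now apply He.
Qed.

Lemma continuous_potential (h : R -> R) : (forall tau, continuous h tau) ->
  forall z, open_disk z -> forall eps, 0 < eps -> exists d, 0 < d /\
    forall z', Rabs (fst z' - fst z) < d -> Rabs (snd z' - snd z) < d ->
      Rabs (neumann_potential h z' - neumann_potential h z) < eps.
Proof.
  intros Hh. pose proof PI_RGT_0 as HPI.
  destruct (bounded_on_period h Hh) as [M [HM0 HM]].
  apply continuous_of_line_derivatives with (fun a b z => - (1 / PI) * grad_log h a b z) (2 * M).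
  - lra.
  - intros z a b t Hz. now apply is_derive_potential.
  - intros z a b Hz. rewrite Rabs_mult, Rabs_Ropp, Rabs_pos_eq.
    2: { apply Rlt_le, Rdiv_lt_0_compat; lra. }
    assert (H := grad_log_bound h M z a b Hh HM0 HM Hz).
    rewrite Rmult_assoc. apply Rmult_le_reg_l with PI; [lra|].
    replace (PI * (1 / PI * (Rabs (grad_log h a b z) * (1 - Cmod z))))
      with (Rabs (grad_log h a b z) * (1 - Cmod z)) by (field; lra). lra.
Qed.

Lemma continuous_poisson (g g' : R -> R) :
  (forall tau, is_derive g tau (g' tau)) -> (forall tau, continuous g' tau) -> g PI = g (- PI) ->
  forall z, open_disk z -> forall eps, 0 < eps -> exists d, 0 < d /\
    forall z', Rabs (fst z' - fst z) < d -> Rabs (snd z' - snd z) < d ->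
      Rabs (poisson g z' - poisson g z) < eps.
Proof.
  intros Hg Hg' Hper. pose proof PI_RGT_0 as HPI.
  destruct (bounded_on_period g' Hg') as [M [HM0 HM]].
  apply continuous_of_line_derivatives with (fun a b z => 1 / PI * grad_log g' (- b) a z) (2 * M).
  - lra.
  - intros z a b t Hz. now apply is_derive_poisson.
  - intros z a b Hz. rewrite Rabs_mult, Rabs_pos_eq.
    2: { apply Rlt_le, Rdiv_lt_0_compat; lra. }
    assert (H := grad_log_bound g' M z (- b) a Hg' HM0 HM Hz). rewrite Rabs_Ropp in H.
    rewrite Rmult_assoc. apply Rmult_le_reg_l with PI; [lra|].
    replace (PI * (1 / PI * (Rabs (grad_log g' (- b) a z) * (1 - Cmod z))))
      with (Rabs (grad_log g' (- b) a z) * (1 - Cmod z)) by (field; lra). lra.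
Qed.

(** The slope is the Poisson integral, bounded by [sup |h|], divided by a radius of at least
    [1 / 2]. The point is that [M] does not depend on [z]. *)
Lemma radial_limit_potential_le (h : R -> R) :
  (forall tau, continuous h tau) -> RInt h (- PI) PI = 0 ->
  exists M, 0 <= M /\ forall z s, closed_disk z -> 1 / 2 <= s < 1 ->
  Rabs (radial_limit (neumann_potential h) z - neumann_potential h (s * fst z, s * snd z))
    <= M * (1 - s).
Proof.
  intros Hh H0.
  destruct (bounded_on_period h Hh) as [M [HM0 HM]].
  exists (2 * M). split; [lra|]. intros z s Hz Hs. apply radial_limit_le; [lra| |exact Hs].
  clear s Hs. intros s s' Hs Hss Hs'.
  rewrite <- (Rminus_0_r (_ - _)), <- (Rmult_0_l (s' - s)).
  apply potential_increment; auto; [lra|]. intros xi Hxi. rewrite Rminus_0_r.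
  assert (Hp : Rabs (poisson h (xi * fst z, xi * snd z)) <= M).
  { apply poisson_abs_le; auto. apply closed_disk_scal; [exact Hz|lra]. }
  rewrite Rabs_div, (Rabs_pos_eq xi) by lra.
  apply Rle_div_l; [lra|]. nra.
Qed.

(** Both sides are close to the value at [(1 - q) * z]: the limit by the uniform bound, the
    potential by its continuity. *)
Lemma radial_limit_potential_interior (h : R -> R) (z : C) :
  (forall tau, continuous h tau) -> RInt h (- PI) PI = 0 -> open_disk z ->
  radial_limit (neumann_potential h) z = neumann_potential h z.
Proof.
  intros Hh H0 Hz. destruct (radial_limit_potential_le h Hh H0) as [M [HM0 HM]].
  apply Rminus_diag_uniq, Rabs_eq_0. apply Rle_antisym; [|apply Rabs_pos].
  apply Rnot_lt_le. intros Hlt. set (e := Rabs _) in Hlt.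
  destruct (continuous_potential h Hh z Hz (e / 2) ltac:(lra)) as [d [Hd Hc]].
  set (q := Rmin (1 / 2) (Rmin (d / 2) (e / (2 * (M + 1))))).
  assert (Hq : 0 < q /\ q <= 1 / 2 /\ q <= d / 2 /\ q * (2 * (M + 1)) <= e).
  { unfold q. repeat split.
    - repeat apply Rmin_pos; try lra. apply Rdiv_lt_0_compat; lra.
    - apply Rmin_l.
    - apply Rle_trans with (1 := Rmin_r _ _), Rmin_l.
    - apply Rle_div_r; [lra|]. apply Rle_trans with (1 := Rmin_r _ _), Rmin_r. }
  assert (Hz' : closed_disk z) by (unfold closed_disk, open_disk in *; lra).
  assert (H1 := HM z (1 - q) Hz' ltac:(lra)).
  destruct (proj1 closed_disk_closed_in_unit_box z Hz') as [B1 B2].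
  assert (H2 := Hc ((1 - q) * fst z, (1 - q) * snd z)).
  specialize (H2 ltac:(simpl; replace ((1 - q) * fst z - fst z) with (- (q * fst z)) by ring;
    rewrite Rabs_Ropp, Rabs_mult, Rabs_pos_eq by lra; nra)
    ltac:(simpl; replace ((1 - q) * snd z - snd z) with (- (q * snd z)) by ring;
    rewrite Rabs_Ropp, Rabs_mult, Rabs_pos_eq by lra; nra)).
  set (v := neumann_potential h ((1 - q) * fst z, (1 - q) * snd z)) in *.
  pose proof (Rabs_triang (radial_limit (neumann_potential h) z - v)
                (v - neumann_potential h z)) as HT.
  replace (radial_limit (neumann_potential h) z - v + (v - neumann_potential h z))
    with (radial_limit (neumann_potential h) z - neumann_potential h z) in HT by ring.
  fold e in HT. nra.
Qed.

(** A uniform limit of the continuous functions obtained by shrinking the argument by [1 - q]: the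
    two replacements cost at most [eps / 4] each, the comparison inside the disk [eps / 2]. *)
Lemma radial_limit_potential_continuous (h : R -> R) :
  (forall tau, continuous h tau) -> RInt h (- PI) PI = 0 ->
  continuous_on closed_disk (radial_limit (neumann_potential h)).
Proof.
  intros Hh H0.
  destruct (radial_limit_potential_le h Hh H0) as [M [HM0 HM]].
  apply continuous_on_eps. intros z Hz eps He.
  set (q := Rmin (1 / 2) (eps / (4 * (M + 1)))).
  assert (Hq : 0 < q /\ q <= 1 / 2 /\ q * (4 * (M + 1)) <= eps).
  { unfold q. repeat split.
    - repeat apply Rmin_pos; try lra. apply Rdiv_lt_0_compat; lra.
    - apply Rmin_l.
    - apply Rle_div_r; [lra|]. apply Rmin_r. }
  assert (Hs : open_disk ((1 - q) * fst z, (1 - q) * snd z)).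
  { apply closed_disk_scal; [exact Hz|lra]. }
  destruct (continuous_potential h Hh _ Hs (eps / 2) ltac:(lra)) as [d [Hd Hc]].
  exists d. split; [exact Hd|]. intros z' Hz' H1 H2.
  assert (E1 := HM z (1 - q) Hz ltac:(lra)). assert (E2 := HM z' (1 - q) Hz' ltac:(lra)).
  assert (E3 := Hc ((1 - q) * fst z', (1 - q) * snd z')).
  specialize (E3 ltac:(simpl; rewrite <- Rmult_minus_distr_l, Rabs_mult, (Rabs_pos_eq (1 - q)) by lra;
                       pose proof (Rabs_pos (fst z' - fst z)); nra)
                 ltac:(simpl; rewrite <- Rmult_minus_distr_l, Rabs_mult, (Rabs_pos_eq (1 - q)) by lra;
                       pose proof (Rabs_pos (snd z' - snd z)); nra)).
  apply Rabs_le_between in E1. apply Rabs_le_between in E2. apply Rabs_def2 in E3.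
  apply Rabs_def1; nra.
Qed.

(** The radial derivative tends to [h t], but it is available only inside the disk. The segment from
    [s] to [1] is therefore cut at [s']: up to [s'] the mean value theorem applies, and the short
    rest is controlled by the Lipschitz bound. *)
Lemma radial_limit_potential_normal (h : R -> R) (t : R) :
  (forall t, h (t + 2 * PI) = h t) -> (forall tau, continuous h tau) -> RInt h (- PI) PI = 0 ->
  filterlim (fun s => (radial_limit (neumann_potential h) (s * cos t, s * sin t)
                       - radial_limit (neumann_potential h) (cos t, sin t)) / (s - 1))
    (at_left 1) (locally (h t)).
Proof.
  intros Hper Hh H0.
  destruct (radial_limit_potential_le h Hh H0) as [M [HM0 HM]].
  intros P [eps HP].
  set (e := eps / 4). assert (He : 0 < e) by (unfold e; pose proof (cond_pos eps); lra).
  destruct (poisson_boundary h t (e / 4) Hper Hh ltac:(lra)) as [d [Hd Hb]].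
  pose proof (Rabs_pos (h t)) as Hht.
  set (q := Rmin (1 / 2) (Rmin d (e / (4 * (Rabs (h t) + 1))))).
  assert (Hq : 0 < q /\ q <= 1 / 2 /\ q <= d /\ q * (4 * (Rabs (h t) + 1)) <= e).
  { unfold q. repeat split.
    - repeat apply Rmin_pos; try lra. apply Rdiv_lt_0_compat; lra.
    - apply Rmin_l.
    - apply Rle_trans with (1 := Rmin_r _ _), Rmin_l.
    - apply Rle_div_r; [lra|]. apply Rle_trans with (1 := Rmin_r _ _), Rmin_r. }
  assert (Hz : closed_disk (cos t, sin t)).
  { apply Cmod_le_1. simpl fst. simpl snd. rewrite <- (sin2_cos2 t). unfold Rsqr. lra. }
  assert (Hp : forall xi, 1 - q < xi < 1 ->
            Rabs (poisson h (xi * cos t, xi * sin t) / xi - h t) <= e).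
  { intros xi Hxi.
    assert (H1 : Rabs (poisson h (xi * cos t, xi * sin t) - h t) < e / 4).
    { apply Hb; [apply (closed_disk_scal (cos t, sin t)); [exact Hz|lra]|].
      replace (Cmod _) with (1 - xi); [lra|].
      rewrite <- (sqrt_pow2 (1 - xi)) by lra. unfold Cmod. f_equal. simpl fst. simpl snd.
      transitivity ((1 - xi) ^ 2 * (Rsqr (sin t) + Rsqr (cos t))).
      - rewrite sin2_cos2. ring.
      - unfold Rsqr. ring. }
    set (p := poisson h (xi * cos t, xi * sin t)) in *.
    (* The two terms of the numerator are at most [e / 4] each, and [e / 2 <= e * xi]. *)
    replace (p / xi - h t) with (((p - h t) + (1 - xi) * h t) / xi) by (field; lra).
    rewrite Rabs_div, (Rabs_pos_eq xi) by lra. apply Rle_div_l; [lra|].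
    apply Rle_trans with (1 := Rabs_triang _ _).
    rewrite Rabs_mult, (Rabs_pos_eq (1 - xi)) by lra. nra. }
  exists (mkposreal q (proj1 Hq)). intros s Hs Hs1. apply HP.
  change (Rabs (s - 1) < q) in Hs. apply Rabs_def2 in Hs.
  assert (Hsd : open_disk (s * cos t, s * sin t)).
  { apply (closed_disk_scal (cos t, sin t)); [exact Hz|lra]. }
  rewrite (radial_limit_potential_interior h _ Hh H0 Hsd).
  set (L := radial_limit (neumann_potential h) (cos t, sin t)) in *.
  set (v := neumann_potential h (s * cos t, s * sin t)).
  change (Rabs ((v - L) / (s - 1) - h t) < eps).
  (* The rest of the segment is the fraction [k] of it, so small that its Lipschitz cost and the
     missing part of the slope [h t] together are at most [e * (1 - s)]. *)
  set (k := Rmin (1 / 2) (e / (M + Rabs (h t) + 1))).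
  assert (Hk : 0 < k /\ k <= 1 / 2 /\ k * (M + Rabs (h t) + 1) <= e).
  { unfold k. repeat split.
    - repeat apply Rmin_pos; try lra. apply Rdiv_lt_0_compat; lra.
    - apply Rmin_l.
    - apply Rle_div_r; [lra|]. apply Rmin_r. }
  set (s' := 1 - (1 - s) * k).
  assert (Hs' : s < s' < 1) by (unfold s'; nra).
  assert (E1 := HM (cos t, sin t) s' Hz ltac:(lra)). simpl fst in E1. simpl snd in E1. fold L in E1.
  assert (E2 := potential_increment h (cos t, sin t) s s' (h t) e Hh H0 Hz ltac:(lra) ltac:(lra) ltac:(lra)).
  simpl fst in E2. simpl snd in E2. specialize (E2 ltac:(intros xi Hxi; apply Hp; lra)). fold v in E2.
  set (v' := neumann_potential h (s' * cos t, s' * sin t)) in *.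
  replace ((v - L) / (s - 1) - h t)
    with (((L - v') + ((v' - v - h t * (s' - s)) + - (h t * (1 - s')))) / (1 - s)) by (field; lra).
  rewrite Rabs_div, (Rabs_pos_eq (1 - s)) by lra. apply Rlt_div_l; [lra|].
  apply Rle_lt_trans with (1 := Rabs_triang _ _).
  apply Rle_lt_trans with (1 := Rplus_le_compat_l _ _ _ (Rabs_triang _ _)).
  rewrite Rabs_Ropp, Rabs_mult, (Rabs_pos_eq (1 - s')) by lra.
  assert (E3 : (M + Rabs (h t)) * (1 - s') <= e * (1 - s)).
  { unfold s'. replace (1 - (1 - (1 - s) * k)) with ((1 - s) * k) by ring. nra. }
  assert (E4 : e * (s' - s) <= e * (1 - s)) by nra.
  replace (pos eps) with (4 * e) by (unfold e; field). nra.
Qed.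

(** * Identification of the solutions *)

Lemma harmonic_of_line_derivatives (f : C -> R) (G : R -> R -> C -> R) :
  (forall z a b t, open_disk (fst z + t * a, snd z + t * b) ->
    is_derive (fun t => f (fst z + t * a, snd z + t * b)) t
      (G a b (fst z + t * a, snd z + t * b))) ->
  (forall z, open_disk z -> exists A B D, A + D = 0 /\ forall a b,
    is_derive (fun t => G a b (fst z + t * a, snd z + t * b)) 0
      (A * a ^ 2 + B * a * b + D * b ^ 2)) ->
  harmonic_in_disk f.
Proof.
  intros Hf HG z Hz. destruct (HG z Hz) as (A & B & D & HAD & H).
  exists A, B, D. split; [exact HAD|]. intros a b.
  exists (fun t => G a b (fst z + t * a, snd z + t * b)). split; [|apply H].
  assert (Hz' : open_disk (fst z + 0 * a, snd z + 0 * b)).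
  { replace (fst z + 0 * a, snd z + 0 * b) with z by (destruct z; simpl; f_equal; ring).
    exact Hz. }
  generalize (open_disk_line z a b 0 Hz'). apply filter_imp. intros t Ht. now apply Hf.
Qed.

Lemma harmonic_potential (h : R -> R) : (forall tau, continuous h tau) ->
  harmonic_in_disk (neumann_potential h).
Proof.
  intros Hh.
  apply harmonic_of_line_derivatives with (fun a b z => - (1 / PI) * grad_log h a b z).
  { intros z a b t Hz. now apply is_derive_potential. }
  intros z Hz. destruct (is_derive_grad_log h z Hz Hh) as (S & T & H).
  exists (- (1 / PI) * S), (- (1 / PI) * (2 * T)), (- (- (1 / PI) * S)). split; [ring|].
  intros a b.
  replace (_ + _) with (- (1 / PI) * ((a * a - b * b) * S + (a * b + b * a) * T)) by ring.
  apply is_derive_scal, H.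
Qed.

Lemma harmonic_poisson (g g' : R -> R) :
  (forall tau, is_derive g tau (g' tau)) -> (forall tau, continuous g' tau) -> g PI = g (- PI) ->
  harmonic_in_disk (poisson g).
Proof.
  intros Hg Hg' Hper.
  apply harmonic_of_line_derivatives with (fun a b z => 1 / PI * grad_log g' (- b) a z).
  { intros z a b t Hz. now apply is_derive_poisson. }
  intros z Hz. destruct (is_derive_grad_log g' z Hz Hg') as (S & T & H).
  exists (1 / PI * T), (- (1 / PI) * (2 * S)), (- (1 / PI * T)). split; [ring|].
  intros a b.
  replace (_ + _) with (1 / PI * ((- b * a - a * b) * S + (- b * b + a * a) * T)) by ring.
  apply is_derive_scal, H.
Qed.

Lemma harmonic_in_disk_ext (f g : C -> R) :
  (forall z, open_disk z -> f z = g z) -> harmonic_in_disk f -> harmonic_in_disk g.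
Proof.
  intros E Hf z Hz. destruct (Hf z Hz) as (A & B & D & HAD & H).
  exists A, B, D. split; [exact HAD|]. intros a b. destruct (H a b) as [f' [H1 H2]].
  exists f'. split; [|exact H2].
  assert (Hz' : open_disk (fst z + 0 * a, snd z + 0 * b)).
  { replace (fst z + 0 * a, snd z + 0 * b) with z by (destruct z; simpl; f_equal; ring).
    exact Hz. }
  assert (Hl := open_disk_line z a b 0 Hz'). apply locally_locally in Hl.
  generalize (filter_and _ _ H1 Hl). apply filter_imp. intros t [Ht Hd].
  revert Ht. apply is_derive_ext_loc. revert Hd. apply filter_imp. intros s. apply E.
Qed.

Lemma dirichlet_solution_eq_poisson (g : R -> R) (u : C -> R) :
  (forall t, g (t + 2 * PI) = g t) -> (forall t, ex_derive g t) ->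
  (forall t, continuous (Derive g) t) -> dirichlet_solution g u ->
  forall z, open_disk z -> u z = poisson g z.
Proof.
  intros Hper Hex Hc [Hh [Hcont Hb]].
  assert (Hg : forall t, is_derive g t (Derive g t)) by (intros; now apply Derive_correct).
  assert (Cg : forall t, continuous g t) by (intros; now apply @ex_derive_continuous).
  assert (HPI : g PI = g (- PI)) by (rewrite <- (Hper (- PI)); f_equal; ring).
  set (U := fun z => if Rlt_dec (Cmod z) 1 then poisson g z else u z).
  assert (HU : forall z, open_disk z -> U z = poisson g z).
  { intros z Hz. unfold U. destruct (Rlt_dec (Cmod z) 1); [reflexivity|contradiction]. }
  assert (HU1 : forall z, Cmod z = 1 -> U z = u z).
  { intros z Hz. unfold U. destruct (Rlt_dec (Cmod z) 1); [lra|reflexivity]. }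
  assert (HUc : continuous_on closed_disk U).
  { apply continuous_on_eps. intros z Hz eps He.
    destruct (Rle_lt_or_eq_dec _ _ Hz) as [H1|H1].
    - destruct (open_disk_box z H1) as [d1 [Hd1 Hd1']].
      destruct (continuous_poisson g (Derive g) Hg Hc HPI z H1 eps He) as [d2 [Hd2 Hd2']].
      exists (Rmin d1 d2). split; [now apply Rmin_pos|]. intros z' _ Hx Hy.
      pose proof (Rmin_l d1 d2). pose proof (Rmin_r d1 d2).
      rewrite (HU z H1), (HU z') by (apply Hd1'; lra). apply Hd2'; lra.
    - rewrite (HU1 z H1).
      destruct (unit_polar (fst z) (snd z)) as [t0 [Hc0 Hs0]]; [now apply Cmod_eq_1|].
      assert (Ez : z = cis t0) by (destruct z; unfold cis; simpl in *; now subst).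
      destruct (poisson_boundary g t0 eps Hper Cg He) as [d1 [Hd1 Hd1']].
      destruct (proj1 (continuous_on_eps _ _) Hcont z Hz eps He) as [d2 [Hd2 Hd2']].
      exists (Rmin (d1 / 2) d2). split; [apply Rmin_pos; lra|]. intros z' Hz' Hx Hy.
      pose proof (Rmin_l (d1 / 2) d2). pose proof (Rmin_r (d1 / 2) d2).
      destruct (Rle_lt_or_eq_dec _ _ Hz') as [H2|H2].
      + rewrite (HU z' H2), Ez, Hb. apply Hd1'; [exact H2|]. rewrite <- Ez.
        pose proof (Cmod_box z z' (d1 / 2) ltac:(lra) ltac:(lra)). lra.
      + rewrite (HU1 z' H2). apply Hd2'; [exact Hz'|lra|lra]. }
  intros z Hz. rewrite <- HU by exact Hz.
  apply harmonic_unique.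
  - now apply harmonic_on_harmonic_in_disk.
  - apply harmonic_in_disk_ext with (poisson g).
    + intros p Hp. now rewrite HU.
    + now apply harmonic_poisson with (Derive g).
  - exact Hcont.
  - exact HUc.
  - intros p Hp. now rewrite HU1.
  - unfold closed_disk, open_disk in *. lra.
Qed.

Lemma neumann_solution_eq_potential (h : R -> R) (w : C -> R) :
  (forall t, h (t + 2 * PI) = h t) -> (forall tau, continuous h tau) -> RInt h (- PI) PI = 0 ->
  neumann_solution h w ->
  exists c, forall z, open_disk z -> w z = neumann_potential h z + c.
Proof.
  intros Hper Hh H0 (Hw & Hcont & Hn & _).
  set (v := radial_limit (neumann_potential h)).
  exists (w (1, 0) + -1 * v (1, 0)). intros z Hz.
  rewrite <- (radial_limit_potential_interior h z Hh H0 Hz). fold v.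
  enough (w z + -1 * v z = w (1, 0) + -1 * v (1, 0)) by lra.
  apply (neumann_unique (fun z => w z + -1 * v z)).
  - intros p Hp. replace 0 with (0 + -1 * 0) by ring.
    apply has_laplacian_plus; [now apply harmonic_on_harmonic_in_disk|].
    apply has_laplacian_scal.
    apply (harmonic_in_disk_ext (neumann_potential h)); [|now apply harmonic_potential|exact Hp].
    intros q Hq. symmetry. now apply radial_limit_potential_interior.
  - apply continuous_on_plus; [exact Hcont|]. apply continuous_on_opp.
    now apply radial_limit_potential_continuous.
  - intros x y Hxy. destruct (unit_polar x y Hxy) as [t [-> ->]].
    assert (L1 := Hn t). unfold has_normal_derivative in L1.
    assert (L2 := radial_limit_potential_normal h t Hper Hh H0). fold v in L2.
    apply filterlim_ext with (fun s : R => (w (RtoC s * cis t)%C - w (cis t)) / (s - 1)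
         + -1 * ((v (s * cos t, s * sin t) - v (cos t, sin t)) / (s - 1))).
    { intros s. replace (RtoC s * cis t)%C with (s * cos t, s * sin t)
        by (unfold cis, Cmult, RtoC; simpl; f_equal; ring).
      unfold cis. unfold Rdiv. ring. }
    replace 0 with (h t + -1 * h t) by ring.
    apply (filterlim_comp_2 _ _ Rplus L1 (filterlim_comp _ _ _ _ (fun r => -1 * r) _ _ _ L2
             (filterlim_scal_r (-1) (h t)))).
    apply (filterlim_plus (h t) (-1 * h t)).
  - unfold closed_disk, open_disk in *. lra.
Qed.

Lemma grad_of_line_derivatives (f F : C -> R) (G : R -> R -> C -> R) (c : R) (z : C) :
  open_disk z -> (forall z, open_disk z -> f z = F z + c) ->
  (forall z a b t, open_disk (fst z + t * a, snd z + t * b) ->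
    is_derive (fun t => F (fst z + t * a, snd z + t * b)) t
      (G a b (fst z + t * a, snd z + t * b))) ->
  grad f z = (G 1 0 z, G 0 1 z).
Proof.
  destruct z as [x y]. intros Hz E HG. unfold grad, dx, dy. simpl fst. simpl snd. f_equal.
  - apply is_derive_unique.
    apply is_derive_ext_loc with (fun t => F (t, y) + c).
    + assert (Hl := open_disk_line (0, y) 1 0 x). simpl in Hl.
      assert (E2 : forall t, (0 + t * 1, y + t * 0) = (t, y)) by (intros; f_equal; ring).
      rewrite E2 in Hl. generalize (Hl Hz). apply filter_imp. intros t Ht.
      rewrite E2 in Ht. now rewrite E.
    + assert (H := HG (0, y) 1 0 x). simpl in H.
      assert (E2 : forall t, (0 + t * 1, y + t * 0) = (t, y)) by (intros; f_equal; ring).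
      rewrite E2 in H. specialize (H Hz).
      replace (G 1 0 (x, y)) with (G 1 0 (x, y) + 0) by ring.
      apply (is_derive_plus (fun t => F (t, y)) (fun _ => c)); [|apply @is_derive_const].
      revert H. apply is_derive_ext. intros t. now rewrite E2.
  - apply is_derive_unique.
    apply is_derive_ext_loc with (fun t => F (x, t) + c).
    + assert (Hl := open_disk_line (x, 0) 0 1 y). simpl in Hl.
      assert (E2 : forall t, (x + t * 0, 0 + t * 1) = (x, t)) by (intros; f_equal; ring).
      rewrite E2 in Hl. generalize (Hl Hz). apply filter_imp. intros t Ht.
      rewrite E2 in Ht. now rewrite E.
    + assert (H := HG (x, 0) 0 1 y). simpl in H.
      assert (E2 : forall t, (x + t * 0, 0 + t * 1) = (x, t)) by (intros; f_equal; ring).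
      rewrite E2 in H. specialize (H Hz).
      replace (G 0 1 (x, y)) with (G 0 1 (x, y) + 0) by ring.
      apply (is_derive_plus (fun t => F (x, t)) (fun _ => c)); [|apply @is_derive_const].
      revert H. apply is_derive_ext. intros t. now rewrite E2.
Qed.

Lemma C1_alpha_continuous_Derive (alpha : R) (g : R -> R) :
  0 < alpha -> C1_alpha_circle alpha g -> forall t, continuous (Derive g) t.
Proof.
  intros Ha (_ & _ & K & HK) t P [eps HP].
  set (L := Rabs K + 1). assert (HL : 0 < L) by (unfold L; pose proof (Rabs_pos K); lra).
  assert (Hq : 0 < eps / L) by (apply Rdiv_lt_0_compat; [apply cond_pos|exact HL]).
  assert (Hd : 0 < Rpower (eps / L) (/ alpha)) by apply exp_pos.
  exists (mkposreal _ Hd). intros s Hs. apply HP.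
  change (Rabs (s - t) < Rpower (eps / L) (/ alpha)) in Hs.
  change (Rabs (Derive g s - Derive g t) < eps).
  destruct (Req_dec s t) as [->|Hst].
  { rewrite Rminus_diag, Rabs_R0. apply cond_pos. }
  apply Rle_lt_trans with (1 := HK s t Hst).
  assert (Hr : Rpower (Rabs (s - t)) alpha < eps / L).
  { replace (eps / L) with (Rpower (Rpower (eps / L) (/ alpha)) alpha).
    - apply Rlt_Rpower_l; [exact Ha|]. split; [|exact Hs]. apply Rabs_pos_lt. lra.
    - rewrite Rpower_mult, Rinv_l, Rpower_1 by lra. reflexivity. }
  assert (Hr0 : 0 < Rpower (Rabs (s - t)) alpha) by apply exp_pos.
  assert (K <= Rabs K) by apply Rle_abs.
  assert (E : eps = L * (eps / L) :> R) by (field; lra).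
  unfold L in *. nra.
Qed.

(* omega may be introduced in either way: by the integral formula, or as a
   classical solution of the Neumann problem. *)
Theorem corollary1p4 (alpha : R) (g : R -> R) (u omega : C -> R)
  (halpha : 0 < alpha < 1)
  (hg : C1_alpha_circle alpha g)
  (hu : dirichlet_solution g u)
  (homega :
    (forall x, open_disk x -> omega x = neumann_potential (Derive g) x) \/
    neumann_solution (Derive g) omega) :
  forall r phi : R, 0 < r < 1 ->
    grad u (r * cis phi)%C = (grad omega (r * cis phi) * cis (PI / 2))%C.
Proof.
  intros r phi Hr.
  assert (Hc := C1_alpha_continuous_Derive alpha g (proj1 halpha) hg).
  destruct hg as (Hper & Hex & _).
  assert (Hg : forall t, is_derive g t (Derive g t)) by (intros; now apply Derive_correct).
  assert (HPI : g PI = g (- PI)) by (rewrite <- (Hper (- PI)); f_equal; ring).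
  assert (Hper' : forall t, Derive g (t + 2 * PI) = Derive g t).
  { intros t. symmetry. apply is_derive_unique.
    apply is_derive_ext with (fun t => g (t + 2 * PI)); [exact Hper|].
    rewrite <- (Rmult_1_l (Derive g (t + 2 * PI))).
    apply (is_derive_comp g (fun t => t + 2 * PI)); [apply Hg|].
    auto_derive; [exact I|ring]. }
  assert (H0 : RInt (Derive g) (- PI) PI = 0).
  { rewrite RInt_Derive; [rewrite HPI; now apply Rminus_diag_eq|auto|auto]. }
  assert (Hw : exists c, forall z, open_disk z ->
                 omega z = neumann_potential (Derive g) z + c).
  { destruct homega as [Hw|Hw].
    - exists 0. intros z Hz. rewrite Hw by exact Hz. ring.
    - now apply neumann_solution_eq_potential. }
  destruct Hw as [c Hw].
  assert (Hz : open_disk (r * cis phi)%C).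
  { replace (r * cis phi)%C with (r * fst (cis phi), r * snd (cis phi))
      by (unfold cis, Cmult, RtoC; simpl; f_equal; ring).
    apply closed_disk_scal; [|lra]. apply Cmod_le_1. unfold cis. simpl fst. simpl snd.
    rewrite <- (sin2_cos2 phi). unfold Rsqr. lra. }
  set (z := (r * cis phi)%C) in *.
  rewrite (grad_of_line_derivatives omega (neumann_potential (Derive g))
             (fun a b z => - (1 / PI) * grad_log (Derive g) a b z) c z Hz Hw).
  2: { intros p a b t Hp. now apply is_derive_potential. }
  rewrite (grad_of_line_derivatives u (poisson g)
             (fun a b z => 1 / PI * grad_log (Derive g) (- b) a z) 0 z Hz).
  2: { intros p Hp. rewrite Rplus_0_r. now apply dirichlet_solution_eq_poisson. }
  2: { intros p a b t Hp. now apply is_derive_poisson. }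
  unfold cis. rewrite cos_PI2, sin_PI2. unfold Cmult. simpl fst. simpl snd.
  assert (E : grad_log (Derive g) (- (1)) 0 z = - grad_log (Derive g) 1 0 z).
  { unfold grad_log. rewrite <- (RInt_opp (V := R_CompleteNormedModule)).
    - apply RInt_ext. intros tau _. unfold opp. simpl. ring_R.
    - generalize (ex_RInt_kernel 0 1 0 0 0 _ z 1 Hz Hc). apply ex_RInt_ext.
      intros tau _. rewrite pow_1. ring_R. }
  rewrite E, Ropp_0. f_equal; ring.
Qed.
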